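(* If a survey dataset $D=\{(q^i,B^i)\}_{i\in[n]}$ with $m$ survey questions and $n$ rounds is peak-oriented rationalizable, then a rationalizing utility function $u(x)$ can be obtained in time polynomial in $m$ and $n$.
   Context: Notation: $[n]=\{1,\dots,n\}$; $\langle\cdot,\cdot\rangle$ is the standard inner product. For a concave function $u$, $\partial u(q)$ is its superdifferential at $q$. Survey dataset: $M_1,\dots,M_m>0$ and $X=\prod_{j=1}^m[0,M_j]$. For each round $i\in[n]$ there are $a^i\in\mathbb{R}^m$ and $\mu^i\in\mathbb{R}$ defining the budget $B^i=\{x\in X:\langle a^i,x\rangle=\mu^i\}$, and an observed answer $q^i$. Standing assumptions: all coordinates of each $a^i$ are nonzero, $B^i$ intersects the interior of $X$, and $q^i\in B^i$. Peak-oriented rationalizability: $D$ is peak-oriented rationalizable if there exist a peak $y^*\in X$, a continuous concave function $u:X\to\mathbb{R}$, and scalars $\lambda^i\in\mathbb{R}$ such that (i) $y^*\in\arg\max_{x\in X}u(x)$; (ii) $q^i\in\arg\max_{x\in B^i}u(x)$ for $i\in[n]$; (iii) $\lambda^i a^i\in\partial u(q^i)$ for $i\in[n]$; (iv) $\lambda^i a^i_j(y^*_j-q^i_j)\ge 0$ for $i\in[n]$, $j\in[m]$; (v) $\langle\lambda^i a^i,y^*-q^i\rangle>0$ for $i\in[n]$ with $q^i\ne y^*$. A rationalizing utility function is a continuous concave $u:X\to\mathbb{R}$ that yields a peak-oriented rationalization of $D$, i.e. for which (i)–(v) hold with some $y^*\in X$ and some scalars $\lambda^i$. Form of the utility function: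 it is given by finitely many parameters through a formula $$u(x)=\min\Bigl\{U^0,\ \min_{i\in I}\bigl[U^i+\eta^i\langle\sigma^i a^i,x-q^i\rangle\bigr]\Bigr\},$$ where $I\subseteq[n]$, $\sigma^i\in\{+1,-1\}$, $U^0,U^i\in\mathbb{R}$ and $\eta^i>0$ (if $I=\varnothing$, $u$ is constant). *)

(* Defs.v *)
From HB Require Import structures.
From mathcomp Require Import all_boot all_order all_algebra.
From mathcomp Require Import all_classical all_reals all_analysis.

Set Implicit Arguments.
Unset Strict Implicit.
Unset Printing Implicit Defensive.

Import Order.TTheory GRing.Theory Num.Theory.
Import numFieldNormedType.Exports.

Local Open Scope classical_set_scope.
Local Open Scope ring_scope.

Section SurveyData.
Variable R : realType.

Definition inner (m : nat) (x y : 'rV[R]_m) : R := \sum_(j < m) x 0 j * y 0 j.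

(* Coordinates and rounds are numbered from 0. *)
Record dataset (m n : nat) := Dataset {
  bound : 'rV[R]_m;
  normal : 'I_n -> 'rV[R]_m;
  level : 'I_n -> R;
  answer : 'I_n -> 'rV[R]_m
}.

Section Rationalizability.
Variables (m n : nat) (D : dataset m n).

Definition box : set 'rV[R]_m :=
  [set x | forall j, 0 <= x 0 j <= bound D 0 j].

Definition budget (i : 'I_n) : set 'rV[R]_m :=
  [set x | box x /\ inner (normal D i) x = level D i].

Definition survey_dataset : Prop :=
  [/\ forall j, 0 < bound D 0 j,
      forall i j, normal D i 0 j != 0,
      forall i, budget i `&` interior box !=set0
    & forall i, budget i (answer D i)].

Definition argmax (A : set 'rV[R]_m) (u : 'rV[R]_m -> R) : set 'rV[R]_m :=
  [set x | A x /\ forall y, A y -> u y <= u x].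

Definition concave_on (A : set 'rV[R]_m) (u : 'rV[R]_m -> R) : Prop :=
  convex_function (E := 'rV[R]_m) A (fun x => - u x).

(* Superdifferential at z of a utility whose domain is the box: only the values
   of u on the box are constrained. *)
Definition superdifferential (u : 'rV[R]_m -> R) (z : 'rV[R]_m) :
    set 'rV[R]_m :=
  [set p | forall x, box x -> u x <= u z + inner p (x - z)].

(* A utility is a total function on R^m of which only the restriction to the
   box matters. *)
Definition peak_oriented_rationalization
    (y : 'rV[R]_m) (u : 'rV[R]_m -> R) (lambda : 'I_n -> R) : Prop :=
  [/\ argmax box u y,
      forall i, argmax (budget i) u (answer D i),
      forall i, superdifferential u (answer D i) (lambda i *: normal D i),
      forall i j,
        0 <= lambda i * normal D i 0 j * (y 0 j - answer D i 0 j)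
    & forall i, answer D i != y ->
        0 < inner (lambda i *: normal D i) (y - answer D i)].

Definition rationalizing_utility (u : 'rV[R]_m -> R) : Prop :=
  [/\ {within box, continuous u},
      concave_on box u
    & exists y lambda, box y /\ peak_oriented_rationalization y u lambda].

Definition peak_oriented_rationalizable : Prop :=
  exists u, rationalizing_utility u.

End Rationalizability.

Record utility_parameters (n : nat) := UtilityParameters {
  active : {set 'I_n};             (* I *)
  sigma_pos : 'I_n -> bool;        (* sigma^i = +1 iff sigma_pos i *)
  top_value : R;                   (* U^0 *)
  value : 'I_n -> R;               (* U^i *)
  slope : 'I_n -> R                (* eta^i *)
}.

Definition sigma (n : nat) (p : utility_parameters n) (i : 'I_n) : R :=
  if sigma_pos p i then 1 else - 1.

Definition valid_parameters (n : nat) (p : utility_parameters n) : Prop :=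
  forall i, i \in active p -> 0 < slope p i.

Definition utility (m n : nat) (D : dataset m n) (p : utility_parameters n)
    (x : 'rV[R]_m) : R :=
  \big[Num.min/top_value p]_(i in active p)
    (value p i + slope p i * inner (sigma p i *: normal D i) (x - answer D i)).

End SurveyData.

(* Model of computation: a real RAM presented as an imperative language.  A
   program is a fixed finite text that cannot depend on m, n or the data.
   Memory consists of numbered two-dimensional arrays of natural numbers and of
   numbered two-dimensional arrays of exact reals; array subscripts are natural
   number expressions.  Every elementary operation has unit cost.  The only
   operations on naturals are +, truncated - and comparison, and on reals
   +, -, *, / and comparison (no rounding, and no conversion from reals to
   naturals other than through branching); the only real constants are
   natural numbers. *)

Inductive nexpr :=
  | NConst of nat
  | NRead of nat & nexpr & nexpr
  | NAdd of nexpr & nexpr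
  | NSub of nexpr & nexpr.

Inductive rexpr :=
  | RConst of nat
  | RRead of nat & nexpr & nexpr
  | RAdd of rexpr & rexpr
  | RSub of rexpr & rexpr
  | RMul of rexpr & rexpr
  | RDiv of rexpr & rexpr.

Inductive bexpr :=
  | NLe of nexpr & nexpr
  | RLe of rexpr & rexpr
  | BNot of bexpr
  | BAnd of bexpr & bexpr.

(* NWrite k e1 e2 e stores e in cell (e1, e2) of natural array number k. *)
Inductive cmd :=
  | Skip
  | NWrite of nat & nexpr & nexpr & nexpr
  | RWrite of nat & nexpr & nexpr & rexpr
  | Seq of cmd & cmd
  | If of bexpr & cmd & cmd
  | While of bexpr & cmd.

Section Semantics.
Variable R : realType.

Record state := State {
  nmem : nat -> nat -> nat -> nat;
  rmem : nat -> nat -> nat -> R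
}.

Definition update (T : Type) (f : nat -> nat -> nat -> T) (k i j : nat) (v : T) :
    nat -> nat -> nat -> T :=
  fun k' i' j' => if [&& k' == k, i' == i & j' == j] then v else f k' i' j'.

Fixpoint neval (s : state) (e : nexpr) : nat :=
  match e with
  | NConst c => c
  | NRead k e1 e2 => nmem s k (neval s e1) (neval s e2)
  | NAdd e1 e2 => (neval s e1 + neval s e2)%N
  | NSub e1 e2 => (neval s e1 - neval s e2)%N
  end.

(* As in MathComp, division by zero returns zero. *)
Fixpoint reval (s : state) (e : rexpr) : R :=
  match e with
  | RConst c => c%:R
  | RRead k e1 e2 => rmem s k (neval s e1) (neval s e2)
  | RAdd e1 e2 => reval s e1 + reval s e2
  | RSub e1 e2 => reval s e1 - reval s e2
  | RMul e1 e2 => reval s e1 * reval s e2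
  | RDiv e1 e2 => reval s e1 / reval s e2
  end.

Fixpoint beval (s : state) (b : bexpr) : bool :=
  match b with
  | NLe e1 e2 => (neval s e1 <= neval s e2)%N
  | RLe e1 e2 => reval s e1 <= reval s e2
  | BNot b1 => ~~ beval s b1
  | BAnd b1 b2 => beval s b1 && beval s b2
  end.

(* The cost of an expression is its number of nodes. *)
Fixpoint ncost (e : nexpr) : nat :=
  match e with
  | NConst _ => 1%N
  | NRead _ e1 e2 | NAdd e1 e2 | NSub e1 e2 => (ncost e1 + ncost e2).+1%N
  end.

Fixpoint rcost (e : rexpr) : nat :=
  match e with
  | RConst _ => 1%N
  | RRead _ e1 e2 => (ncost e1 + ncost e2).+1%N
  | RAdd e1 e2 | RSub e1 e2 | RMul e1 e2 | RDiv e1 e2 =>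
      (rcost e1 + rcost e2).+1%N
  end.

Fixpoint bcost (b : bexpr) : nat :=
  match b with
  | NLe e1 e2 => (ncost e1 + ncost e2).+1%N
  | RLe e1 e2 => (rcost e1 + rcost e2).+1%N
  | BNot b1 => (bcost b1).+1
  | BAnd b1 b2 => (bcost b1 + bcost b2).+1%N
  end.

(* exec c s t s': started in s, the program c halts in s' after time t. *)
Inductive exec : cmd -> state -> nat -> state -> Prop :=
  | ExecSkip s : exec Skip s 1 s
  | ExecNWrite s k e1 e2 e :
      exec (NWrite k e1 e2 e) s (ncost e1 + ncost e2 + ncost e).+1
        (State (update (nmem s) k (neval s e1) (neval s e2) (neval s e))
               (rmem s))
  | ExecRWrite s k e1 e2 e :
      exec (RWrite k e1 e2 e) s (ncost e1 + ncost e2 + rcost e).+1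
        (State (nmem s)
               (update (rmem s) k (neval s e1) (neval s e2) (reval s e)))
  | ExecSeq c1 c2 s s1 s2 t1 t2 :
      exec c1 s t1 s1 -> exec c2 s1 t2 s2 ->
      exec (Seq c1 c2) s (t1 + t2).+1 s2
  | ExecIf b c1 c2 s s1 t :
      exec (if beval s b then c1 else c2) s t s1 ->
      exec (If b c1 c2) s (bcost b + t).+1 s1
  | ExecWhileEnd b c s :
      ~~ beval s b -> exec (While b c) s (bcost b).+1 s
  | ExecWhileStep b c s s1 s2 t1 t2 :
      beval s b -> exec c s t1 s1 -> exec (While b c) s1 t2 s2 ->
      exec (While b c) s (bcost b + t1 + t2).+1 s2.

Section InputOutput.
Variables (m n : nat).

Definition cell (l : nat) (f : 'I_l -> R) (i : nat) : R := oapp f 0 (insub i).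

(* Input: m and n in cells (0, 0) and (0, 1) of natural array 0; M, a, mu and q
   in real arrays 0 to 3, with M_j in cell (0, j), a^i_j and q^i_j in cell
   (i, j) and mu^i in cell (i, 0).  All the other cells are 0. *)
Definition input_state (D : dataset R m n) : state :=
  State
    (fun k i j =>
       if (k == 0%N) && (i == 0%N) then
         match j with 0 => m | 1 => n | _ => 0%N end
       else 0%N)
    (fun k i j =>
       match k with
       | 0 => if i == 0%N then cell (fun j' => bound D 0 j') j else 0
       | 1 => cell (fun i' => cell (fun j' => normal D i' 0 j') j) i
       | 2 => if j == 0%N then cell (level D) i else 0
       | 3 => cell (fun i' => cell (fun j' => answer D i' 0 j') j) i
       | _ => 0
       end).

(* Output: I and the signs in natural arrays 1 and 2 (as nonzero flags in cell
   (i, 0)), and U^0, U^i, eta^i in real arrays 4, 5 and 6. *)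
Definition output (s : state) : utility_parameters R n :=
  UtilityParameters
    [set i : 'I_n | nmem s 1 i 0 != 0%N]%SET
    (fun i => nmem s 2 i 0 != 0%N)
    (rmem s 4 0 0)
    (fun i => rmem s 5 i 0)
    (fun i => rmem s 6 i 0).

End InputOutput.
End Semantics.

(* Main.v *)
Require Import Defs.
From mathcomp Require Import all_boot all_order all_algebra.
From mathcomp Require Import all_classical all_reals all_analysis.
From mathcomp Require Import zify ring lra.

Set Implicit Arguments.
Unset Strict Implicit.
Unset Printing Implicit Defensive.

Import Order.TTheory GRing.Theory Num.Theory.
Import numFieldNormedType.Exports.

Local Open Scope classical_set_scope.
Local Open Scope ring_scope.

(** The proof exhibits a program that tries polynomially many points [y] as the
peak and, for each of them, either finds a utility function or shows that no
rationalization has this peak.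

_One peak._ If the answer [q i] is not [y], then [lambda i * <a i, y - q i>] is
positive, so that [lambda i] has the sign of the score [s i = <a i, y - q i>];
that [y] lies in the orthant at [q i] with these signs can be tested
coordinatewise. What is left is an Afriat problem: utility levels [U] and
positive slopes with [U k <= U i + slope i * <sigma i a i, q k - q i>] for all
[i] and [k]. The peak joins in as one more answer, number [n], with normal
vector 0. Put [g i k = s i * <a i, q k - q i>] (the gain). If [V] is at least
[- g i k] when [g i k <= 0] and at least [1 / g i k] otherwise, and [d = 1 / (1
+ V * V)], then the levels [- w i] with slopes [V * w i * |s i|] solve the
problem as soon as the positive weights [w] satisfy [w i <= d * w k] when [g i
k < 0] and [w i <= w k] when [g i k = 0]. Powers [w i = d ^+ c i] work, where
the exponent [c i] counts the answers whose utility lies below that of [q i] in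
a given rationalization (and is [n] at the peak). So the weights are found as
in the Bellman-Ford method: start from 1 and lower a weight whenever an
inequality fails. Each sweep that changes something increases the sum of the
exponents, which is bounded by the sum of the counts, so that [(n + 1) ^ 2]
sweeps suffice. The program then checks the Afriat inequalities, which makes
its output correct for whatever peak passes the test ([certified_sound]); peaks
that occur in a rationalization pass it ([certified_complete]).

_Few peaks._ If the peak is an answer, trying the answers is enough. Otherwise
all signs are determined, the peaks that agree with these signs form a box, and
its lowest corner serves as well as the original peak. Every coordinate of the
corner is 0 or a coordinate of an answer. The sign of [lambda i] can be read
off from any single coordinate in which the corner differs from [q i]. Let [j0]
be the least index such that every answer differs from the corner somewhere up
to [j0]. If [j0 > 0], some answer [q i0] agrees with the corner before [j0],
and any answer does if [j0 = 0], so replacing the coordinate [j0] of [q i0] by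
that of the corner (which is 0 or [q k0 j0]) gives a point that determines all
signs and, through them, the corner. It remains to run over all triples [i0],
[j0], [k0] ([exists_winning]).

_Running time._ All loops of the program count up to [m] or [n], plus at most
2. Such programs denote total functions on states ([run]), and a nest of [e]
loops takes time polynomial of degree [e] ([exec_run]); everything else is
reasoning about these functions. *)

(** * Programs with counted loops *)

(** In [PFor v x y c] the counter is cell (0, 0) of natural array [v]; it runs
from 0 to the bound, excluded, which is cell (0, [x]) of the array of sizes (so
[m] or [n]) plus [y]. *)
Inductive prog :=
  | PSkip
  | PNat of nat & nexpr & nexpr & nexpr
  | PReal of nat & nexpr & nexpr & rexpr
  | PSeq of prog & prog
  | PIf of bexpr & prog & prog
  | PFor of nat & nat & nat & prog.

Definition counter (v : nat) : nexpr := NRead v (NConst 0) (NConst 0).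

Definition loop_bound (x y : nat) : nexpr :=
  NAdd (NRead 0 (NConst 0) (NConst x)) (NConst y).

Fixpoint translate (c : prog) : cmd :=
  match c with
  | PSkip => Skip
  | PNat k e1 e2 e => NWrite k e1 e2 e
  | PReal k e1 e2 e => RWrite k e1 e2 e
  | PSeq c1 c2 => Seq (translate c1) (translate c2)
  | PIf b c1 c2 => If b (translate c1) (translate c2)
  | PFor v x y c =>
      Seq (NWrite v (NConst 0) (NConst 0) (NConst 0))
        (While (BNot (NLe (loop_bound x y) (counter v)))
           (Seq (translate c)
              (NWrite v (NConst 0) (NConst 0)
                 (NAdd (counter v) (NConst 1)))))
  end.

Fixpoint nat_written (c : prog) : seq nat :=
  match c with
  | PSkip | PReal _ _ _ _ => [::]
  | PNat k _ _ _ => [:: k]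
  | PSeq c1 c2 | PIf _ c1 c2 => nat_written c1 ++ nat_written c2
  | PFor v _ _ c => v :: nat_written c
  end.

Fixpoint real_written (c : prog) : seq nat :=
  match c with
  | PSkip | PNat _ _ _ _ => [::]
  | PReal k _ _ _ => [:: k]
  | PSeq c1 c2 | PIf _ c1 c2 => real_written c1 ++ real_written c2
  | PFor _ _ _ c => real_written c
  end.

(** The sizes are never overwritten and a loop body leaves its own counter
alone, so that the number of iterations is known when the loop is entered; the
limit on [y] lets one number bound all loops. *)
Fixpoint well_formed (c : prog) : bool :=
  match c with
  | PSkip | PReal _ _ _ _ => true
  | PNat k _ _ _ => k != 0%N
  | PSeq c1 c2 | PIf _ c1 c2 => well_formed c1 && well_formed c2
  | PFor v _ y c =>
      [&& v != 0%N, (y <= 2)%N, v \notin nat_written c & well_formed c]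
  end.

Fixpoint nesting (c : prog) : nat :=
  match c with
  | PSeq c1 c2 | PIf _ c1 c2 => maxn (nesting c1) (nesting c2)
  | PFor _ _ _ c => (nesting c).+1
  | _ => 0%N
  end.

Fixpoint weight (c : prog) : nat :=
  match c with
  | PSkip => 1%N
  | PNat _ e1 e2 e => (ncost e1 + ncost e2 + ncost e).+1
  | PReal _ e1 e2 e => (ncost e1 + ncost e2 + rcost e).+1
  | PSeq c1 c2 => (weight c1 + weight c2).+1
  | PIf b c1 c2 => (bcost b + weight c1 + weight c2).+1
  (* An iteration costs 20 besides its body, entering and leaving the loop 16. *)
  | PFor _ _ _ c => (weight c + 36)%N
  end.

Section Run.
Variable R : realType.
Implicit Types s t : state R.

Definition set_counter (v x : nat) s : state R :=
  State (update (nmem s) v 0 0 x) (rmem s).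

(** The state after iteration [i] already has the counter at [i + 1], exactly as
the translated while loop leaves it. *)
Fixpoint run (c : prog) s : state R :=
  match c with
  | PSkip => s
  | PNat k e1 e2 e =>
      State (update (nmem s) k (neval s e1) (neval s e2) (neval s e)) (rmem s)
  | PReal k e1 e2 e =>
      State (nmem s) (update (rmem s) k (neval s e1) (neval s e2) (reval s e))
  | PSeq c1 c2 => run c2 (run c1 s)
  | PIf b c1 c2 => if beval s b then run c1 s else run c2 s
  | PFor v x y c =>
      iteri (nmem s 0 0 x + y) (fun i s' => set_counter v i.+1 (run c s'))
        (set_counter v 0 s)
  end.

Lemma updateE (T : Type) (f : nat -> nat -> nat -> T) k i j x k' i' j' :
  update f k i j x k' i' j' =
    if [&& k' == k, i' == i & j' == j] then x else f k' i' j'.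
Proof. by []. Qed.

Lemma update_other (T : Type) (f : nat -> nat -> nat -> T) k i j x k' :
  k' != k -> update f k i j x k' = f k'.
Proof. by move=> /negPf kk; do 2 (apply: funext => ?); rewrite /update kk. Qed.

Lemma nmem_run c s k : k \notin nat_written c -> nmem (run c s) k = nmem s k.
Proof.
elim: c s => //=.
- by move=> k0 e1 e2 e s; rewrite inE => kk; rewrite update_other.
- by move=> c1 IH1 c2 IH2 s; rewrite mem_cat negb_or => /andP[? ?]; rewrite IH2 ?IH1.
- move=> b c1 IH1 c2 IH2 s; rewrite mem_cat negb_or => /andP[? ?].
  by case: ifP => _; [rewrite IH1|rewrite IH2].
- move=> v x y c IH s; rewrite inE negb_or => /andP[kv kc].
  elim: (nmem s 0 0 x + y)%N => [|N IHN] /=; first by rewrite update_other.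
  by rewrite update_other// IH// IHN.
Qed.

Lemma rmem_run c s k : k \notin real_written c -> rmem (run c s) k = rmem s k.
Proof.
elim: c s => //=.
- by move=> k0 e1 e2 e s; rewrite inE => kk; rewrite update_other.
- by move=> c1 IH1 c2 IH2 s; rewrite mem_cat negb_or => /andP[? ?]; rewrite IH2 ?IH1.
- move=> b c1 IH1 c2 IH2 s; rewrite mem_cat negb_or => /andP[? ?].
  by case: ifP => _; [rewrite IH1|rewrite IH2].
- move=> v x y c IH s kc.
  by elim: (nmem s 0 0 x + y)%N => [|N IHN] //=; rewrite IH// IHN.
Qed.

Lemma well_formed_nmem0 c s : well_formed c -> nmem (run c s) 0 = nmem s 0.
Proof.
move=> wf; apply: nmem_run.
elim: c wf => //= [k _ _ _|c1 IH1 c2 IH2|_ c1 IH1 c2 IH2|v _ y c IH].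
- by rewrite inE eq_sym.
- by move=> /andP[/IH1 ? /IH2 ?]; rewrite mem_cat negb_or; apply/andP.
- by move=> /andP[/IH1 ? /IH2 ?]; rewrite mem_cat negb_or; apply/andP.
- by move=> /and4P[v0 _ _ /IH]; rewrite inE eq_sym (negPf v0).
Qed.

(** Each level of nesting multiplies the time by at most [L], a bound on all
loop bounds. *)
Lemma exec_run c s (L : nat) :
    well_formed c -> (forall x, nmem s 0 0 x + 2 <= L)%N ->
  exists2 t, exec (translate c) s t (run c s) & (t <= weight c * L ^ nesting c)%N.
Proof.
elim: c s => [|k e1 e2 e|k e1 e2 e|c1 IH1 c2 IH2|b c1 IH1 c2 IH2|v x y c IH] s /=.
- by move=> _ _; exists 1%N => //; constructor.
- by move=> _ _; eexists; [constructor|rewrite muln1].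
- by move=> _ _; eexists; [constructor|rewrite muln1].
- move=> /andP[wf1 wf2] bL.
  have L1 : (0 < L)%N by apply: leq_trans (bL 0%N); rewrite addn2.
  have [t1 e1 l1] := IH1 s wf1 bL.
  have [|t2 e2 l2] := IH2 (run c1 s) wf2; first by rewrite well_formed_nmem0.
  exists (t1 + t2).+1; first by econstructor; eauto.
  have l3 := leq_maxl (nesting c1) (nesting c2).
  have l4 := leq_maxr (nesting c1) (nesting c2).
  have := leq_pexp2l L1 l3; have := leq_pexp2l L1 l4.
  have : (0 < L ^ maxn (nesting c1) (nesting c2))%N by rewrite expn_gt0 L1.
  nia.
- move=> /andP[wf1 wf2] bL.
  have L1 : (0 < L)%N by apply: leq_trans (bL 0%N); rewrite addn2.
  have l3 := leq_maxl (nesting c1) (nesting c2).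
  have l4 := leq_maxr (nesting c1) (nesting c2).
  have := leq_pexp2l L1 l3; have := leq_pexp2l L1 l4.
  have : (0 < L ^ maxn (nesting c1) (nesting c2))%N by rewrite expn_gt0 L1.
  case: ifP => sb.
    have [t e l] := IH1 s wf1 bL.
    by exists (bcost b + t).+1; [constructor; rewrite sb|nia].
  have [t e l] := IH2 s wf2 bL.
  by exists (bcost b + t).+1; [constructor; rewrite sb|nia].
- move=> /and4P[v0 y2 vc wf] bL.
  have L1 : (0 < L)%N by apply: leq_trans (bL 0%N); rewrite addn2.
  set N := (nmem s 0 0 x + y)%N.
  set stage := fun i => iteri i (fun i s' => set_counter v i.+1 (run c s'))
    (set_counter v 0 s).
  have NL : (N <= L)%N by apply: leq_trans (bL x); rewrite leq_add2l.
  have stage0 i : nmem (stage i) 0 = nmem s 0.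
    elim: i => [|i IHi] /=; first by rewrite update_other// eq_sym.
    by rewrite update_other 1?eq_sym// well_formed_nmem0.
  have stagev i : nmem (stage i) v 0 0 = i.
    by case: i => [|i] /=; rewrite updateE !eqxx.
  have guard i : beval (stage i) (BNot (NLe (loop_bound x y) (counter v))) =
      (i < N)%N by rewrite /= stage0 stagev -ltnNge.
  have loop d i : (i + d = N)%N -> exists2 t,
      exec (While (BNot (NLe (loop_bound x y) (counter v)))
             (Seq (translate c) (NWrite v (NConst 0) (NConst 0)
                (NAdd (counter v) (NConst 1))))) (stage i) t (stage N)
      & (t <= d * (20 + weight c * L ^ nesting c) + 11)%N.
    elim: d i => [|d IHd] i iN.
      rewrite addn0 in iN; rewrite -iN.
      by eexists; [apply: ExecWhileEnd; rewrite guard iN ltnn|].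
    have [|t1 e1 l1] := IH (stage i) wf; first by rewrite stage0.
    have [|t2 e2 l2] := IHd i.+1; first by rewrite -iN addnS.
    eexists.
      apply: (ExecWhileStep (s1 := stage i.+1)); last exact: e2.
        by rewrite guard -iN; lia.
      apply: ExecSeq; first exact: e1.
      have -> : stage i.+1 = State (update (nmem (run c (stage i))) v
          (neval (run c (stage i)) (NConst 0)) (neval (run c (stage i)) (NConst 0))
          (neval (run c (stage i)) (NAdd (counter v) (NConst 1))))
          (rmem (run c (stage i))).
        by rewrite /= nmem_run// stagev addn1.
      exact: ExecNWrite.
    by rewrite /=; nia.
  have [t e l] := loop N 0%N (add0n N).
  eexists; first by apply: ExecSeq; [exact: ExecNWrite|exact: e].
  have : (0 < L ^ nesting c)%N by rewrite expn_gt0 L1.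
  rewrite expnS /=; nia.
Qed.

(** Everything that a program does not write is left alone. *)
Definition unwritten (c : prog) s t : Prop :=
  (forall k, k \notin nat_written c -> nmem t k = nmem s k) /\
  (forall k, k \notin real_written c -> rmem t k = rmem s k).

(** The Hoare rule for loops.  What the body does not write comes for free
through [unwritten], so that [P] need only describe the arrays that the loop
changes; it must not depend on the counter. *)
Lemma for_ind (P : nat -> state R -> Prop) v x y c s :
    well_formed (PFor v x y c) ->
    P 0%N (set_counter v 0 s) ->
    (forall i t, P i t -> P i (set_counter v i t)) ->
    (forall i t, (i < nmem s 0 0 x + y)%N -> unwritten (PFor v x y c) s t ->
       nmem t v 0 0 = i -> P i t -> P i.+1 (run c t)) ->
  P (nmem s 0 0 x + y)%N (run (PFor v x y c) s).
Proof.
move=> /= /and4P[v0 y2 vc wf] P0 stab step.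
set stage := fun i => iteri i (fun i s' => set_counter v i.+1 (run c s'))
  (set_counter v 0 s).
suff [] : P (nmem s 0 0 x + y)%N (stage (nmem s 0 0 x + y)%N) /\
  unwritten (PFor v x y c) s (stage (nmem s 0 0 x + y)%N) by [].
have: (nmem s 0 0 x + y <= nmem s 0 0 x + y)%N by [].
elim: {-2}(nmem s 0 0 x + y)%N => [_|i IHi] /=.
  split=> //; split=> //= k; rewrite inE negb_or => /andP[kv _].
  by rewrite update_other.
move=> iN; have [Pi [un ur]] := IHi (ltnW iN).
have vi : nmem (stage i) v 0 0 = i by case: (i) => [|?] /=; rewrite updateE !eqxx.
split; last split=> k /=.
- by apply: stab; apply: step.
- move=> kn; have := kn; rewrite /= inE negb_or => /andP[kv kc].
  by rewrite update_other// nmem_run// un.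
- by move=> kc; rewrite rmem_run// ur.
Qed.

End Run.

(** * Minima of affine functions *)

Section Inner.
Variables (R : realType) (m : nat).
Implicit Types p x y : 'rV[R]_m.

Lemma innerZl k p x : inner (k *: p) x = k * inner p x.
Proof. by rewrite mulr_sumr; apply: eq_bigr => j _; rewrite mxE mulrA. Qed.

Lemma inner_subr p x y : inner p (x - y) = inner p x - inner p y.
Proof.
by rewrite -sumrB; apply: eq_bigr => j _; rewrite !mxE mulrBr.
Qed.

Lemma inner_continuous p z : continuous (fun x => inner p (x - z) : R^o).
Proof.
have -> : (fun x => inner p (x - z)) =
    fun x => \sum_(j < m) (p 0 j * (x 0 j - z 0 j) : R^o).
  by apply: funext => x; apply: eq_bigr => j _; rewrite !mxE.
move=> x; apply: (@cvg_big R^o _ +%R 0 _ (@add_continuous R^o) _ (nbhs x) _ _ _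
    (nbhs_filter x)) => j _.
apply: cvgMl_tmp; apply: cvgB; [exact: coord_continuous|exact: cvg_cst].
Qed.

End Inner.

Section Utility.
Variables (R : realType) (m n : nat) (D : dataset R m n).
Variable p : utility_parameters R n.

Let piece i x :=
  value p i + slope p i * inner (sigma p i *: normal D i) (x - answer D i).

Lemma utility_le_top x : utility D p x <= top_value p.
Proof. exact: bigmin_le_id. Qed.

Lemma utility_le_piece x i : i \in active p -> utility D p x <= piece i x.
Proof. exact: bigmin_le_cond. Qed.

Lemma le_utility x r : r <= top_value p ->
  (forall i, i \in active p -> r <= piece i x) -> r <= utility D p x.
Proof. exact: le_bigmin. Qed.

Lemma pieceE i x : piece i x = value p i + (slope p i * sigma p i) *
  inner (normal D i) (x - answer D i).
Proof. by rewrite /piece innerZl mulrA. Qed.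

Lemma utility_concave : concave_on (box D) (utility D p).
Proof.
move=> t x y _ _; rewrite convRE /unstable.onem !mulrN -opprD lerN2.
set z := conv _ _ _.
have zE : z = t%:num *: x + (1 - t%:num) *: y by [].
have t0 : 0 <= t%:num by [].
have t1 : 0 <= 1 - t%:num by rewrite subr_ge0.
apply: le_utility => [|i ai].
  have := ler_wpM2l t0 (utility_le_top x); have := ler_wpM2l t1 (utility_le_top y).
  rewrite /=; lra.
have := ler_wpM2l t0 (utility_le_piece x ai).
have := ler_wpM2l t1 (utility_le_piece y ai).
rewrite !pieceE.
have -> : inner (normal D i) (z - answer D i) =
    t%:num * inner (normal D i) (x - answer D i) +
    (1 - t%:num) * inner (normal D i) (y - answer D i).
  rewrite !mulr_sumr -big_split /=; apply: eq_bigr => j _.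
  rewrite zE !mxE; ring.
rewrite /=.
set u := utility D p x; set v := utility D p y; lra.
Qed.

Lemma utility_continuous : continuous (utility D p : _ -> R^o).
Proof.
move=> x; apply: (@cvg_big R^o _ Num.min (top_value p) _ (@min_continuous _ R) _
  (nbhs x) _ _ _ (nbhs_filter x)) => i _.
apply: cvgD; first exact: cvg_cst.
by apply: cvgMl_tmp; exact: inner_continuous.
Qed.

End Utility.

(** * Testing a peak *)

Lemma leq_node n i : (i <= n)%N = (i < n + 1)%N.
Proof. by rewrite addn1 ltnS. Qed.

Section Certificate.
Variables (R : realType) (m n : nat) (M : nat -> R) (a q : nat -> nat -> R).

(** The data are functions on pairs of naturals, as in memory.  Row [n] of [q]
holds the peak under test, and row [n] of [a] is 0. *)
Definition score (i : nat) : R := \sum_(j < m) a i j * (q n j - q i j).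

(** Multiplying by the score instead of by its sign saves a case distinction:
answers that coincide with the peak get the zero vector as their normal. *)
Definition gain (i k : nat) : R :=
  \sum_(j < m) score i * a i j * (q k j - q i j).

(** A sum of nonnegative terms is a common upper bound that takes no comparison
to compute. *)
Definition steepness : R :=
  1 + \sum_(i < n + 1) \sum_(k < n + 1)
        if gain i k <= 0 then 0 - gain i k else 1 / gain i k.

Definition decay : R := 1 / (1 + steepness * steepness).

(** One step of the Bellman-Ford method, in multiplicative form. *)
Definition relaxed (i k : nat) (p : nat -> R) (x : nat) : R :=
  if x == i then
    if gain i k < 0 then Num.min (p i) (decay * p k)
    else if gain i k <= 0 then Num.min (p i) (p k) else p i
  else p x.

Definition sweep (p : nat -> R) : nat -> R :=
  iteri (n + 1) (fun i => iteri (n + 1) (fun k => relaxed i k)) p.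

Definition weights : nat -> R :=
  iter (n + 1) (iter (n + 1) sweep) (fun=> 1).

Definition in_box : bool := [forall j : 'I_m, (0 <= q n j) && (q n j <= M j)].

(** A test [0 <= score i * t] would accept a point different from [q i] whose
score vanishes by cancellation. *)
Definition in_orthants : bool :=
  [forall i : 'I_n, forall j : 'I_m, let t := a i j * (q n j - q i j) in
     (t * t <= 0) || (0 < score i * t)].

Definition consistent (p : nat -> R) : bool :=
  [forall i : 'I_(n + 1), forall k : 'I_(n + 1),
     0 - p k <= 0 - p i + steepness * p i * gain i k].

Definition certified : bool := [&& in_box, in_orthants & consistent weights].

(** The multiplier [steepness * weights i * score i] of [normal D i] splits into
its sign and its absolute value. *)
Definition certified_parameters (o : utility_parameters R n) : Prop :=
  [/\ forall i, (i \in active o) = (score i != 0),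
      forall i, sigma_pos o i = (0 <= score i),
      top_value o = - weights n,
      forall i, value o i = - weights i
    & forall i, slope o i = steepness * weights i * `|score i|].

Lemma steepness_ge1 : 1 <= steepness.
Proof.
rewrite lerDl; apply: sumr_ge0 => i _; apply: sumr_ge0 => k _.
case: (leP (gain i k) 0) => g; first by rewrite sub0r oppr_ge0.
by rewrite div1r invr_ge0 ltW.
Qed.

Lemma steepness_bound i k : (i <= n)%N -> (k <= n)%N ->
  (if gain i k <= 0 then 0 - gain i k else 1 / gain i k) <= steepness.
Proof.
rewrite (leq_node n i) (leq_node n k) => li lk.
set F := fun i k => if gain i k <= 0 then 0 - gain i k else 1 / gain i k.
have F0 x y : 0 <= F x y.
  rewrite /F; case: (leP (gain x y) 0) => g; first by rewrite sub0r oppr_ge0.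
  by rewrite div1r invr_ge0 ltW.
rewrite -[X in X <= _]/(F i k) /steepness (bigD1 (Ordinal li))//= (bigD1 (Ordinal lk))//=.
rewrite -/(F i k) addrCA -[leLHS]addr0 -addrA lerD// addr_ge0//.
  by apply: sumr_ge0 => y _; exact: F0.
by rewrite addr_ge0//; apply: sumr_ge0 => x _; apply: sumr_ge0 => y _; exact: F0.
Qed.

Lemma steepness_gt0 : 0 < steepness.
Proof. by apply: lt_le_trans steepness_ge1. Qed.

Lemma decay_gt0 : 0 < decay.
Proof. by rewrite /decay div1r invr_gt0 addr_gt0// mulr_gt0// steepness_gt0. Qed.

Lemma decay_lt1 : decay < 1.
Proof. by rewrite /decay div1r invf_lt1 ?addr_gt0// ?ltrDl ?mulr_gt0 ?steepness_gt0. Qed.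

Lemma iteri_inv (T : Type) (P : T -> Prop) k (f : nat -> T -> T) x :
  (forall i y, (i < k)%N -> P y -> P (f i y)) -> P x -> P (iteri k f x).
Proof.
elim: k => //= k IH Pf Px; apply: (Pf) => //; apply: IH => // i y ik.
by apply: Pf; rewrite ltnS ltnW.
Qed.

Lemma weights_gt0 i : 0 < weights i.
Proof.
pose P (p : nat -> R) := forall i, 0 < p i.
suff /(_ i) : P weights by [].
have sweepP p : P p -> P (sweep p).
  apply: iteri_inv => {}i r _; apply: iteri_inv => k {}r _ Pr x.
  rewrite /relaxed; case: eqP => // _; case: ifP => _.
    by rewrite lt_min Pr mulr_gt0 ?decay_gt0.
  by case: ifP => // _; rewrite lt_min !Pr.
have sweepsP l r : P r -> P (iter l sweep r).
  by move=> Pr; elim: l => //= l; exact: sweepP.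
rewrite /weights; elim: {1}(n + 1)%N => [x|k IH]; first exact: ltr01.
by rewrite iterS; exact: sweepsP.
Qed.

Section Sound.
Variables (D : dataset R m n) (o : utility_parameters R n).
Hypothesis MD : forall j : 'I_m, M j = bound D 0 j.
Hypothesis aD : forall (i : 'I_n) (j : 'I_m), a i j = normal D i 0 j.
Hypothesis qD : forall (i : 'I_n) (j : 'I_m), q i j = answer D i 0 j.
Hypothesis an : forall j : 'I_m, a n j = 0.
Hypothesis surveyD : survey_dataset D.

Let y : 'rV[R]_m := \row_j q n j.

Let score_n : score n = 0.
Proof. by apply: big1 => j _; rewrite an mul0r. Qed.

Let gain_n k : gain n k = 0.
Proof. by apply: big1 => j _; rewrite score_n !mul0r. Qed.

Lemma scoreE (i : 'I_n) : inner (normal D i) (y - answer D i) = score i.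
Proof. by apply: eq_bigr => j _; rewrite !mxE aD qD. Qed.

Lemma gainE (i k : 'I_n) :
  score i * inner (normal D i) (answer D k - answer D i) = gain i k.
Proof.
by rewrite mulr_sumr; apply: eq_bigr => j _; rewrite !mxE aD !qD mulrA.
Qed.

Lemma gain_peak (i : 'I_n) : gain i n = score i * score i.
Proof.
by rewrite /gain {3}/score mulr_sumr; apply: eq_bigr => j _; rewrite mulrA.
Qed.

(** The Afriat inequalities between active answers make the piece of [q k] the
lowest one at [q k]; those towards row [n] make the constant piece the lowest
one at the peak. *)
Lemma certified_sound : certified -> certified_parameters o ->
  valid_parameters o /\ rationalizing_utility D (utility D o).
Proof.
case: surveyD => M0 a0 _ qB.
move=> /and3P[/forallP box_y /forallP orth /forallP cons] [actE sigE topE valE slopeE].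
have V0 := steepness_gt0.
have w0 := weights_gt0.
have {cons} le_w i k : (i <= n)%N -> (k <= n)%N ->
    - weights k <= - weights i + steepness * weights i * gain i k.
  rewrite (leq_node n i) (leq_node n k) => li lk.
  by have /forallP/(_ (Ordinal lk)) /= := cons (Ordinal li); rewrite !sub0r.
have Vw0 i : 0 < steepness * weights i by rewrite mulr_gt0.
have valid : valid_parameters o.
  by move=> i; rewrite actE slopeE => s0; rewrite mulr_gt0// normr_gt0.
split=> //.
have slopesigma i : slope o i * sigma o i = steepness * weights i * score i.
  rewrite slopeE /sigma sigE; case: (leP 0 (score i)) => s0.
    by rewrite mulr1 ger0_norm.
  by rewrite ltr0_norm// mulrN1 mulrN opprK.
have orth_y (i : 'I_n) (j : 'I_m) : y 0 j != answer D i 0 j ->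
    0 < score i * (normal D i 0 j * (y 0 j - answer D i 0 j)).
  move=> yq; have /forallP/(_ j) /= := orth i.
  rewrite aD qD mxE; set t := _ * (_ - _).
  have t0 : t != 0 by rewrite mulf_neq0// subr_eq0; move: yq; rewrite mxE.
  by rewrite leNgt -expr2 exprn_even_gt0//= t0.
have inactive i : i \notin active o -> answer D i = y.
  rewrite actE negbK => /eqP s0; apply/rowP => j.
  by apply/eqP/contraT; rewrite eq_sym => /orth_y; rewrite s0 mul0r ltxx.
have box_y' : box D y.
  by move=> j; have := box_y j; rewrite mxE MD.
pose u := utility D o.
have u_y : u y = - weights n.
  apply/eqP; rewrite eq_le; apply/andP; split.
    by rewrite -topE utility_le_top.
  apply: le_utility => [|i ai]; first by rewrite topE.
  rewrite pieceE slopesigma scoreE valE -mulrA -gain_peak.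
  exact: le_w (ltnW (ltn_ord i)) (leqnn n).
have peak : argmax (box D) u y.
  by split=> // x _; rewrite u_y -topE utility_le_top.
have u_q (i : 'I_n) : i \in active o -> u (answer D i) = - weights i.
  move=> ai; apply/eqP; rewrite eq_le; apply/andP; split.
    apply: le_trans (utility_le_piece _ _ ai) _.
    by rewrite pieceE subrr valE /inner big1 ?mulr0 ?addr0// => j _; rewrite mxE mulr0.
  apply: le_utility => [|k ak].
    have := le_w n i (leqnn n) (ltnW (ltn_ord i)).
    by rewrite gain_n mulr0 addr0 topE.
  rewrite pieceE slopesigma valE -mulrA gainE.
  by apply: le_w; exact: ltnW.
have super (i : 'I_n) : superdifferential D u (answer D i)
    ((steepness * weights i * score i) *: normal D i).
  move=> x xbox; have [ai|ai] := boolP (i \in active o).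
    rewrite u_q// innerZl -slopesigma -valE -pieceE.
    exact: utility_le_piece.
  rewrite (inactive _ ai); move: ai; rewrite actE negbK => /eqP ->.
  by rewrite innerZl mulr0 mul0r addr0; apply: peak.2.
split.
- apply: continuous_subspaceT; exact: utility_continuous.
- exact: utility_concave.
exists y, (fun i => steepness * weights i * score i); split=> //; split=> //.
- move=> i; split=> // x [xbox xb].
  have := super i x xbox; rewrite innerZl inner_subr xb.
  by have [_ ->] := qB i; rewrite subrr mulr0 addr0.
- move=> i j; have [->|yq] := eqVneq (y 0 j) (answer D i 0 j).
    by rewrite subrr mulr0.
  by rewrite -!mulrA mulrA ltW// mulr_gt0// orth_y.
- move=> i qy; rewrite innerZl scoreE -mulrA mulr_gt0// -expr2.
  rewrite exprn_even_gt0//= -actE; apply: contraT => /inactive.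
  by move=> /eqP; rewrite (negPf qy).
Qed.

End Sound.
End Certificate.

(** * The peak of a rationalization passes the test *)

Section Complete.
Variables (R : realType) (m n : nat) (M : nat -> R) (a q : nat -> nat -> R).

Local Notation gain := (gain m n a q).
Local Notation score := (score m n a q).
Local Notation decay := (decay m n a q).
Local Notation steepness := (steepness m n a q).
Local Notation relaxed := (relaxed m n a q).
Local Notation sweep := (sweep m n a q).
Local Notation weights := (weights m n a q).

(** The inequalities on the weights [decay ^+ c i], read on the exponents. *)
Definition respects (c : nat -> nat) (i k : nat) : bool :=
  ((gain i k < 0) ==> (c k < c i)%N) && ((gain i k <= 0) ==> (c k <= c i)%N).

Definition settled (c : nat -> nat) : Prop :=
  forall i k, (i < n + 1)%N -> (k < n + 1)%N -> respects c i k.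

Definition total (c : nat -> nat) : nat := (\sum_(i < n + 1) c i)%N.

Section Converge.
Variable rank : nat -> nat.
Hypothesis rank_le : forall i, (rank i <= n)%N.
Hypothesis rank_settled : settled rank.

Definition tracked (c : nat -> nat) (p : nat -> R) : Prop :=
  forall i, (i < n + 1)%N -> p i = decay ^+ c i /\ (c i <= rank i)%N.

Definition progress (r : nat) (p : nat -> R) : Prop :=
  exists2 c, tracked c p & settled c \/ (r <= total c)%N.

(** Halfway through a sweep that started from the exponents [c]: either nothing
has changed yet and the pairs visited so far are in order, or some change has
occurred, which happens only if [c] was not settled. *)
Definition sweeping (c : nat -> nat) (done : nat -> nat -> Prop)
    (p : nat -> R) : Prop :=
  exists2 c', tracked c' p &
    ((forall i, (i < n + 1)%N -> c' i = c i) /\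
     (forall i k, (i < n + 1)%N -> (k < n + 1)%N -> done i k -> respects c i k))
    \/ ((total c < total c')%N /\ ~ settled c).

Lemma expr_decay (k l : nat) : (decay ^+ k < decay ^+ l) = (l < k)%N.
Proof. by rewrite ltr_iXn2l ?decay_gt0 ?decay_lt1. Qed.

Lemma min_decay (k l : nat) : Num.min (decay ^+ k) (decay ^+ l) = decay ^+ maxn k l.
Proof.
by rewrite minElt expr_decay /maxn; case: ltngtP => // ->.
Qed.

Lemma sweeping_relaxed c (done : nat -> nat -> Prop) i k p :
  (i < n + 1)%N -> (k < n + 1)%N -> sweeping c done p ->
  sweeping c (fun i' k' => done i' k' \/ (i' = i /\ k' = k)) (relaxed i k p).
Proof.
move=> li lk [c' tr cc'].
(* The exponent of the lowered weight. *)
pose ci := if gain i k < 0 then maxn (c' i) (c' k).+1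
           else if gain i k <= 0 then maxn (c' i) (c' k) else c' i.
pose c2 x := if x == i then ci else c' x.
have [pi ri] := tr i li; have [pk rk] := tr k lk.
have /andP[/implyP lt_rank /implyP le_rank] := rank_settled li lk.
have tr2 : tracked c2 (relaxed i k p).
  move=> x lx; rewrite /relaxed /c2; case: eqP => [->|_]; last exact: tr.
  rewrite /ci; case: ifP => [g|_].
    by rewrite pi pk -exprS min_decay geq_max ri; split=> //; apply: leq_ltn_trans (lt_rank g).
  case: ifP => [g|_]; last by [].
  by rewrite pi pk min_decay geq_max ri; split=> //; apply: leq_trans (le_rank g).
have ge_c' x : (c' x <= c2 x)%N.
  rewrite /c2; case: eqP => // ->; rewrite /ci.
  by case: ifP => _; [|case: ifP => _]; rewrite ?leq_maxl.
have ge_total : (total c' <= total c2)%N by apply: leq_sum => x _; exact: ge_c'.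
exists c2 => //; case: cc' => [[cc' dn]|[lt ns]]; last first.
  by right; split=> //; apply: leq_trans ge_total.
have [resp|resp] := boolP (respects c i k).
  left; split=> [x lx|i' k' li' lk' [|[-> ->]//]]; last exact: dn.
  rewrite /c2; case: eqP => [->|_]; last exact: cc'.
  rewrite /ci !cc'//; move: resp => /andP[/implyP h1 /implyP h2].
  case: ifP => [/h1 /maxn_idPl//|_].
  by case: ifP => [/h2 /maxn_idPl//|_].
right; split; last by move=> /(_ i k li lk); rewrite (negPf resp).
have -> : total c = total c' by apply: eq_bigr => x _; rewrite cc'.
rewrite /total (bigD1 (Ordinal li))//= [X in (_ < X)%N](bigD1 (Ordinal li))//=.
rewrite -addSn leq_add//; last by apply: leq_sum => x _; exact: ge_c'.
rewrite /c2 eqxx /ci !cc'//; move: resp; rewrite negb_and !negb_imply -!leqNgt -!ltnNge.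
case/orP => /andP[g l]; rewrite g ?leq_max ?ltnS ?l ?orbT//.
by case: ifP => _; rewrite leq_max ?ltnS ?l ?(ltnW l) orbT.
Qed.

(** A sweep without any change has checked all pairs; every change increases the
total. *)
Lemma progress_sweep r p : progress r p -> progress r.+1 (sweep p).
Proof.
move=> [c tr dis].
have : sweeping c (fun _ _ => True) (sweep p).
  pose row (i : nat) i' (k' : nat) := (i' < i)%N.
  suff /(_ (n + 1)%N (leqnn _)) [c' tr' cc'] : forall i, (i <= n + 1)%N ->
      sweeping c (row i)
        (iteri i (fun i => iteri (n + 1) (fun k => relaxed i k)) p).
    exists c' => //; case: cc' => [[cc' dn]|]; [left|by right].
    by split=> // i k li lk _; exact: dn.
  elim=> [_|i IHi li]; first by exists c => //; left; split.
  have {IHi} := IHi (ltnW li); rewrite [iteri i.+1 _ _]/=.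
  set p' := iteri i _ _ => sw.
  have : sweeping c (fun i' k' => row i i' k' \/ i' = i /\ (k' < n + 1)%N)
      (iteri (n + 1) (fun k => relaxed i k) p').
    have : (n + 1 <= n + 1)%N by [].
    elim: {-2}(n + 1)%N => [_|k IHk lk] /=.
      case: sw => c' tr' cc'; exists c' => //; case: cc' => [[cc' dn]|]; [left|by right].
      by split=> // i' k' li' lk' [|[_ ]//]; exact: dn.
    have := sweeping_relaxed li lk (IHk (ltnW lk)).
    move=> [c' tr' cc']; exists c' => //; case: cc' => [[cc' dn]|]; [left|by right].
    split=> // i' k' li' lk' [r'|[-> kk]]; apply: dn => //; first by left; left.
    by move: kk; rewrite ltnS leq_eqVlt => /orP[/eqP ->|l]; [right|left; right].
  move=> [c' tr' cc']; exists c' => //; case: cc' => [[cc' dn]|]; [left|by right].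
  split=> // i' k' li' lk'; rewrite /row ltnS leq_eqVlt => /orP[/eqP ->|l].
    by apply: dn => //; right.
  by apply: dn => //; left.
move=> [c' tr' cc']; exists c' => //; case: cc' => [[cc' dn]|[lt ns]].
  left => i k li lk; rewrite /respects !cc'//; exact: dn.
by right; case: dis => // le; apply: leq_ltn_trans lt.
Qed.

(** The total never exceeds that of [rank], which is less than the number of
sweeps. *)
Lemma weights_settled : exists2 c, tracked c weights & settled c.
Proof.
suff : progress ((n + 1) * (n + 1)) weights.
  move=> [c tr [st|big]]; first by exists c.
  suff : (total c <= (n + 1) * n)%N by nia.
  apply: (@leq_trans (\sum_(i < n + 1) n)%N); last by rewrite sum_nat_const card_ord.
  by apply: leq_sum => i _; have [_ /leq_trans] := tr i (ltn_ord i); apply.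
have sweeps l r p : progress r p -> progress (l + r) (iter l sweep p).
  by move=> pr; elim: l => //= l; exact: progress_sweep.
rewrite /weights; elim: {1 3}(n + 1)%N => [|l IH] /=; last first.
  by rewrite mulSn; exact: sweeps.
by exists (fun=> 0%N) => //; right.
Qed.

Lemma consistent_weights : consistent m n a q weights.
Proof.
have [c tr st] := weights_settled.
apply/forallP => i; apply/forallP => k; rewrite !sub0r.
have [pi _] := tr i (ltn_ord i); have [pk _] := tr k (ltn_ord k).
have /andP[/implyP h1 /implyP h2] := st i k (ltn_ord i) (ltn_ord k).
have := @steepness_bound R m n a q i k.
rewrite (leq_node n i) (leq_node n k) => /(_ (ltn_ord _) (ltn_ord _)).
have V0 := steepness_gt0 m n a q.
have p0 := @weights_gt0 R m n a q i; have pk0 := @weights_gt0 R m n a q k.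
case: (ltgtP (gain i k) 0) => [g|g|g].
- move=> bd.
  have pd : weights i <= decay * weights k.
    rewrite pi pk -exprS; rewrite le_eqVlt expr_decay.
    by case: (ltngtP (c k).+1 (c i)) (h1 g) => // [_ _|->]; rewrite ?orbT ?eqxx.
  have dE : decay * (1 + steepness * steepness) = 1.
    by rewrite /decay div1r mulVf// gt_eqF// addr_gt0// mulr_gt0.
  have : weights i * (1 + steepness * steepness) <= weights k.
    have := ler_wpM2r (ltW (addr_gt0 ltr01 (mulr_gt0 V0 V0))) pd.
    by rewrite mulrAC dE mul1r.
  have : weights i * steepness * (- gain i k) <= weights i * steepness * steepness.
    apply: ler_wpM2l; first by rewrite mulr_ge0 ?ltW.
    by rewrite -[leLHS]sub0r.
  lra.
- move=> bd; have : 1 <= steepness * gain i k by rewrite -ler_pdivrMr.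
  nra.
- move=> _; rewrite g mulr0 addr0 lerN2.
  rewrite pi pk le_eqVlt expr_decay; have := h2.
  by rewrite g lexx leq_eqVlt => /(_ isT) /orP[/eqP ->|->]; rewrite ?eqxx ?orbT.
Qed.

End Converge.

Section Rationalized.
Variables (lam U : nat -> R).
Hypothesis a_neq0 : forall i j, (i < n)%N -> (j < m)%N -> a i j != 0.
Hypothesis a_n : forall j, a n j = 0.
Hypothesis box_q : in_box m n M q.
Hypothesis lam_orthant : forall i j, (i < n)%N -> (j < m)%N ->
  0 <= lam i * (a i j * (q n j - q i j)).
Hypothesis lam_neq0 : forall i j, (i < n)%N -> (j < m)%N -> q i j != q n j ->
  lam i != 0.
Hypothesis afriat : forall i k, (i < n)%N -> (k < n)%N ->
  U k <= U i + lam i * \sum_(j < m) a i j * (q k j - q i j).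

Let score_n : score n = 0.
Proof. by apply: big1 => j _; rewrite a_n mul0r. Qed.

Let lam_score i j : (i < n)%N -> (j < m)%N -> q i j != q n j ->
  0 < lam i * (a i j * (q n j - q i j)) /\ 0 < lam i * score i.
Proof.
move=> li lj qq.
have pos : 0 < lam i * (a i j * (q n j - q i j)).
  rewrite lt0r lam_orthant// !mulf_neq0//; first exact: lam_neq0 qq.
    exact: a_neq0.
  by rewrite subr_eq0 eq_sym.
split=> //; rewrite /score mulr_sumr (bigD1 (Ordinal lj))//= ltr_wpDr//.
by apply: sumr_ge0 => k _; exact: lam_orthant.
Qed.

Let orthants : in_orthants m n a q.
Proof.
apply/forallP => i; apply/forallP => j /=.
have [->|qq] := eqVneq (q i j) (q n j); first by rewrite subrr !mulr0 lexx.
have [tp sp] := lam_score (ltn_ord i) (ltn_ord j) qq.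
apply/orP; right; have := mulr_gt0 tp sp.
set t := a i j * _.
have -> : lam i * t * (lam i * score i) = lam i ^+ 2 * (score i * t) by ring.
by rewrite pmulr_rgt0// exprn_even_gt0//= (lam_neq0 _ _ qq).
Qed.

Let active (i : nat) : bool := (i < n)%N && (score i != 0).

Let inactive i j : (i < n + 1)%N -> (j < m)%N -> ~~ active i -> q i j = q n j.
Proof.
rewrite addn1 ltnS leq_eqVlt /active => /orP[/eqP -> //|li] lj.
rewrite li /= negbK => s0; apply/eqP/contraT => /(lam_score li lj) [_].
by rewrite (eqP s0) mulr0 ltxx.
Qed.

Let inactive_score i : (i < n + 1)%N -> ~~ active i -> score i = 0.
Proof.
rewrite addn1 ltnS leq_eqVlt /active => /orP[/eqP -> //|->].
by rewrite negbK => /eqP.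
Qed.

Let active_lam i : active i -> 0 < lam i * score i.
Proof.
move=> /andP[li s0].
have [/existsP[j /(lam_score li (ltn_ord j)) []//]|] :=
  boolP [exists j : 'I_m, q i j != q n j].
rewrite negb_exists => /forallP qq; case/eqP: s0; apply: big1 => j _.
by have := qq j; rewrite negbK => /eqP ->; rewrite subrr mulr0.
Qed.

Let gain_active i k : gain i k = score i * \sum_(j < m) a i j * (q k j - q i j).
Proof. by rewrite mulr_sumr; apply: eq_bigr => j _; rewrite mulrA. Qed.

Let gain_inactive i k : (k < n + 1)%N -> ~~ active k -> gain i k = score i * score i.
Proof.
move=> lk nk; rewrite gain_active; congr (_ * _); apply: eq_bigr => j _.
by rewrite (inactive lk).
Qed.

(** Answers that coincide with the peak, and the peak itself, have the highest
possible rank; the others are ranked by their utility in the rationalization. *)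
Let below (i : nat) : {set 'I_n} := [set k : 'I_n | active k && (U k < U i)].

Let rank i := if active i then #|below i| else n.

Let rank_le i : (rank i <= n)%N.
Proof.
by rewrite /rank; case: ifP => // _; rewrite -[leqRHS]card_ord max_card.
Qed.

Let rank_settled : settled rank.
Proof.
move=> i k li lk; apply/andP.
have [ak|nk] := boolP (active k); last first.
  rewrite gain_inactive//; split; apply/implyP.
    by rewrite ltNge -expr2 sqr_ge0.
  rewrite -expr2 => s2; suff ni : ~~ active i by rewrite /rank (negPf ni) rank_le.
  rewrite /active negb_and negbK; apply/orP; right.
  by rewrite -sqrf_eq0 eq_le s2 sqr_ge0.
have [ai|ni] := boolP (active i); last first.
  rewrite gain_active inactive_score// mul0r ltxx; split=> //; apply/implyP => _.
  by rewrite {2}/rank (negPf ni).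
have sp := active_lam ai.
have [[lin _] [lkn _]] := (andP ai, andP ak).
have af := afriat lin lkn.
set d := \sum_(j < m) _ in af.
have gE : lam i ^+ 2 * gain i k = (lam i * score i) * (lam i * d).
  by rewrite gain_active -/d; ring.
have l2 : 0 < lam i ^+ 2.
  rewrite exprn_even_gt0//=; apply: contraTneq sp => ->; by rewrite mul0r ltxx.
rewrite /rank ai ak; split; apply/implyP => g.
  have ld : lam i * d < 0 by rewrite -(pmulr_rlt0 _ sp) -gE pmulr_rlt0.
  have Uki : U k < U i by lra.
  apply: proper_card; apply/properP; split.
    by apply/fintype.subsetP => x; rewrite !inE => /andP[-> /lt_trans]; apply.
  by exists (Ordinal lkn); rewrite !inE ak /= ?ltxx.
have ld : lam i * d <= 0 by rewrite -(pmulr_rle0 _ sp) -gE pmulr_rle0.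
apply: subset_leq_card; apply/fintype.subsetP => x.
by rewrite !inE => /andP[-> Ux]; apply: lt_le_trans Ux _; lra.
Qed.

(** A gain that is not positive means that the utility does not increase from
[q i] to [q k], so that ranks respect the gains and bound the exponents. *)
Lemma certified_complete : certified m n M a q.
Proof.
by rewrite /certified box_q orthants (consistent_weights rank_le rank_settled).
Qed.

End Rationalized.
End Complete.

(** * Candidate peaks *)

Section Candidates.
Variables (R : realType) (m n : nat) (M : nat -> R) (a q : nat -> nat -> R).

Definition placed (i0 j0 k0 j : nat) : R := if j == j0 then q k0 j else q i0 j.

Definition first_nonzero (d : nat -> R) : R :=
  iteri m (fun j x => if x == 0 then d j else x) 0.

(** The least nonnegative values above the lower bounds that the signs [s] impose
on a peak.  The upper bounds that they impose then hold too, if any peak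
satisfies all of them. *)
Definition corner (s : nat -> R) (r : nat -> nat -> R) (j : nat) : R :=
  iteri n (fun i x => if (0 < s i * a i j) && (x < r i j) then r i j else x) 0.

(** A nonzero real whose sign is that of [lambda i] if row [n] of [r] agrees with
the peak up to its first difference with [r i]. *)
Definition side (r : nat -> nat -> R) (i : nat) : R :=
  first_nonzero (fun j => a i j * (r n j - r i j)).

(** [q1] and [q2] are the tables after [placed] and after the move to the corner.
Beyond column [m] their row [n] is arbitrary.  So is the row placed from
[i0 = n]: this case serves only when there are no answers, and then the corner
is 0 anyway. *)
Definition winning (i0 j0 k0 : nat) : Prop := forall q1 q2 : nat -> nat -> R,
  (forall i j, i != n -> q1 i j = q i j) ->
  (i0 != n -> forall j, (j < m)%N -> q1 n j = placed i0 j0 k0 j) ->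
  (forall i j, i != n -> q2 i j = q i j) ->
  (forall j, (j < m)%N -> q2 n j = corner (side q1) q1 j) ->
  certified m n M a q1 \/ certified m n M a q2.

Lemma first_nonzeroP (d : nat -> R) f : (f < m)%N -> d f != 0 ->
  exists f0, [/\ (f0 <= f)%N, d f0 != 0 & first_nonzero d = d f0].
Proof.
have main l : (forall j, (j < l)%N -> d j = 0) /\
    iteri l (fun j x => if x == 0 then d j else x) 0 = 0 \/
  exists f0, [/\ (f0 < l)%N, d f0 != 0,
    iteri l (fun j x => if x == 0 then d j else x) 0 = d f0 &
    forall j, (j < f0)%N -> d j = 0].
  elim: l => [|l [[dl0 IH]|[f0 [l0 df0 IH dl]]]]; first by left.
    rewrite /= IH eqxx; have [dl|dl] := eqVneq (d l) 0.
      by left; split=> // j; rewrite ltnS leq_eqVlt => /orP[/eqP ->|/dl0].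
    by right; exists l; split.
  by right; exists f0; split=> //=; [apply: ltnW|rewrite IH (negPf df0)].
move=> fm df; case: (main m) => [[/(_ f fm) df0]|[f0 [_ df0 e dl]]].
  by rewrite df0 eqxx in df.
by exists f0; split=> //; rewrite leqNgt; apply: contra df => /dl ->.
Qed.

Section Peak.
Variables (lam U ystar : nat -> R).
Hypothesis a_neq0 : forall i j, (i < n)%N -> (j < m)%N -> a i j != 0.
Hypothesis a_n : forall j, a n j = 0.
Hypothesis q_zero : forall j, q (n + 1) j = 0.
Hypothesis box_y : forall j, (j < m)%N -> 0 <= ystar j <= M j.
Hypothesis lam_orthant : forall i j, (i < n)%N -> (j < m)%N ->
  0 <= lam i * (a i j * (ystar j - q i j)).
Hypothesis lam_neq0 : forall i j, (i < n)%N -> (j < m)%N -> q i j != ystar j ->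
  lam i != 0.
Hypothesis afriat : forall i k, (i < n)%N -> (k < n)%N ->
  U k <= U i + lam i * \sum_(j < m) a i j * (q k j - q i j).

Let neq_n i : (i < n)%N -> i != n. Proof. by move/ltn_eqF ->. Qed.

Lemma certified_peak (q' : nat -> nat -> R) (y : nat -> R) :
  (forall i j, i != n -> q' i j = q i j) ->
  (forall j, (j < m)%N -> q' n j = y j) ->
  (forall j, (j < m)%N -> 0 <= y j <= M j) ->
  (forall i j, (i < n)%N -> (j < m)%N -> 0 <= lam i * (a i j * (y j - q i j))) ->
  (forall i j, (i < n)%N -> (j < m)%N -> q i j != y j -> lam i != 0) ->
  certified m n M a q'.
Proof.
move=> q'i q'n box_y' lam_o lam_n.
apply: (@certified_complete R m n M a q' lam U) => //.
- by apply/forallP => j; rewrite q'n ?box_y'.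
- by move=> i j li lj; rewrite q'n// q'i ?neq_n// lam_o.
- by move=> i j li lj; rewrite q'n// q'i ?neq_n//; exact: lam_n.
- move=> i k li lk; apply: (le_trans (afriat li lk)); rewrite lerD2l le_eqVlt.
  apply/orP; left; apply/eqP; congr (_ * _); apply: eq_bigr => j _.
  by rewrite !q'i ?neq_n.
Qed.

(** If the peak, or the lowest corner that replaces it, is an answer, then this
answer is placed unchanged ([j0 = m] is out of range).  Otherwise [j0] is the
least index up to which every answer has been told apart from the corner.  Row
[n + 1] of the table is 0, which provides the coordinate 0. *)
Lemma exists_winning :
  exists i0 j0 k0, [/\ (i0 <= n)%N, (j0 <= m)%N, (k0 <= n + 1)%N, k0 != n &
    winning i0 j0 k0].
Proof.
have n1 : (n + 1)%N != n by rewrite addn1 neq_ltn ltnSn orbT.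
have place_answer (y : nat -> R) (i0 : 'I_n) :
    (forall j, (j < m)%N -> 0 <= y j <= M j) ->
    (forall i j, (i < n)%N -> (j < m)%N -> 0 <= lam i * (a i j * (y j - q i j))) ->
    (forall i j, (i < n)%N -> (j < m)%N -> q i j != y j -> lam i != 0) ->
    (forall j : 'I_m, q i0 j = y j) ->
    winning i0 m (n + 1).
  move=> by_ lo ln qy q1 q2 q1i q1n _ _; left.
  apply: (certified_peak q1i _ by_ lo ln) => j lj.
  rewrite q1n ?neq_n// /placed (ltn_eqF lj); exact: (qy (Ordinal lj)).
have [/existsP[i0 /forallP qy]|] :=
  boolP [exists i0 : 'I_n, forall j : 'I_m, q i0 j == ystar j].
  exists i0, m, (n + 1)%N; split=> //; first exact: ltnW.
  by apply: (place_answer ystar) => // j; apply/eqP.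
rewrite negb_exists => /forallP noy.
have lam0 i : (i < n)%N -> lam i != 0.
  move=> li; have := noy (Ordinal li); rewrite negb_forall => /existsP[j].
  exact: lam_neq0.
pose low := corner lam q.
have low_ge0 j : 0 <= low j.
  rewrite /low /corner; apply: (@iteri_inv _ (fun x => 0 <= x)) => // i y _ y0.
  by case: ifP => // /andP[_ /ltW]; exact: le_trans.
have low_ge i j : (i < n)%N -> 0 < lam i * a i j -> q i j <= low j.
  move=> + la; rewrite /low /corner; elim: (n) => // l IH.
  rewrite ltnS leq_eqVlt => /orP[/eqP <-|/IH le] /=.
    by rewrite la /=; case: ltP.
  by case: ifP => // /andP[_ /ltW]; exact: le_trans.
have low_val j : low j = 0 \/ exists2 k, (k < n)%N & low j = q k j.
  rewrite /low /corner.
  apply: (@iteri_inv _ (fun x => x = 0 \/ exists2 k, (k < n)%N & x = q k j)); last by left.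
  by move=> i y li IH; case: ifP => // _; right; exists i.
have low_le j : (j < m)%N -> low j <= ystar j.
  move=> lj; apply: (@iteri_inv _ (fun x => x <= ystar j)); last by have /andP[] := box_y lj.
  move=> i y li IH; case: ifP => // /andP[la _].
  by have := lam_orthant li lj; rewrite mulrA pmulr_rge0// subr_ge0.
have low_box j : (j < m)%N -> 0 <= low j <= M j.
  move=> lj; rewrite low_ge0 (le_trans (low_le _ lj))//.
  by have /andP[] := box_y lj.
have low_orthant i j : (i < n)%N -> (j < m)%N -> 0 <= lam i * (a i j * (low j - q i j)).
  move=> li lj; rewrite mulrA; have [la|la|la] := ltgtP 0 (lam i * a i j).
  - by rewrite pmulr_rge0// subr_ge0 low_ge.
  - rewrite nmulr_rge0// subr_le0 (le_trans (low_le _ lj))//.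
    by have := lam_orthant li lj; rewrite mulrA nmulr_rge0// subr_le0.
  - by rewrite -la mul0r.
have low_neq0 i j : (i < n)%N -> (j < m)%N -> q i j != low j -> lam i != 0.
  by move=> li _ _; exact: lam0.
have [/existsP[i0 /forallP qy]|] :=
  boolP [exists i0 : 'I_n, forall j : 'I_m, q i0 j == low j].
  exists i0, m, (n + 1)%N; split=> //; first exact: ltnW.
  by apply: (place_answer low) => // j; apply/eqP.
rewrite negb_exists => /forallP nolow.
pose split_at j := [forall i : 'I_n, exists f : 'I_m, (f <= j)%N && (q i f != low f)].
have ex_split : exists j, split_at j.
  exists m; apply/forallP => i; have := nolow i; rewrite negb_forall.
  by move=> /existsP[f qf]; apply/existsP; exists f; rewrite qf ltnW.
case: (ex_minnP ex_split) => j0 spl_j0 min_j0.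
have j0m : (j0 <= m)%N.
  apply: min_j0; apply/forallP => i; have := nolow i; rewrite negb_forall.
  by move=> /existsP[f qf]; apply/existsP; exists f; rewrite qf ltnW.
have [i0 [i0n i0E agree]] : exists i0, [/\ (i0 <= n)%N, i0 = n -> n = 0%N &
    forall f, (f < m)%N -> (f < j0)%N -> q i0 f = low f].
  case: j0 spl_j0 min_j0 j0m => [|j' _ min_j0 _]; first by exists 0%N; split.
  have : ~~ split_at j' by apply/negP => /min_j0; rewrite ltnn.
  rewrite negb_forall => /existsP[i0]; rewrite negb_exists => /forallP ag.
  exists i0; split=> [|i0n|f lf fj']; first exact: ltnW.
    by have := ltn_ord i0; rewrite i0n ltnn.
  by apply/eqP; have := ag (Ordinal lf); rewrite /= -ltnS fj' negbK.
have [k0 [k0n k0E lowj0]] : exists k0, [/\ (k0 <= n + 1)%N, k0 != n & q k0 j0 = low j0].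
  have [->|[k lk ->]] := low_val j0; first by exists (n + 1)%N.
  by exists k; rewrite neq_n// (leq_trans (ltnW lk))// addn1.
exists i0, j0, k0; split=> // q1 q2 q1i q1n q2i q2n; right.
apply: (certified_peak q2i _ low_box low_orthant low_neq0) => j lj.
rewrite q2n//.
have q1_low f : i0 != n -> (f < m)%N -> (f <= j0)%N -> q1 n f = low f.
  move=> i0n' fm; rewrite q1n// /placed leq_eqVlt; case: eqP => [-> _|_ /=]; first exact: lowj0.
  exact: agree.
(* The first difference of row [n] and answer [i] occurs up to [j0], where the
   row is the corner. *)
have side_pos i : (i < n)%N -> 0 < lam i * side q1 i.
  move=> li; have i0n' : i0 != n by apply/eqP => /i0E n0; rewrite n0 in li.
  have /forallP/(_ (Ordinal li)) /existsP[f /andP[fj0 qf]] := spl_j0.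
  have nz g : (g < m)%N -> (g <= j0)%N ->
      a i g * (q1 n g - q1 i g) = a i g * (low g - q i g).
    by move=> gm gj; rewrite q1_low// q1i// neq_n.
  have [|f0 [f0f nz0 sideE]] :=
      first_nonzeroP (d := fun j => a i j * (q1 n j - q1 i j)) (ltn_ord f).
    by rewrite nz// mulf_neq0 ?a_neq0// subr_eq0 eq_sym.
  have f0m := leq_ltn_trans f0f (ltn_ord f).
  rewrite /side sideE nz ?(leq_trans f0f)// in nz0 *.
  by rewrite lt0r low_orthant// mulf_neq0// lam0.
(* The sides have the signs of [lam], so that both corners take the same
   maxima. *)
rewrite /low /corner; elim: {-2}n (leqnn n) => // l IH ln /=.
rewrite IH ?(ltnW ln)// q1i ?neq_n//.
have lp := side_pos l ln.
suff -> : (0 < side q1 l * a l j) = (0 < lam l * a l j) by [].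
have e : (lam l * side q1 l) * (side q1 l * a l j) =
    side q1 l ^+ 2 * (lam l * a l j) by ring.
have s2 : 0 < side q1 l ^+ 2.
  by rewrite exprn_even_gt0//=; apply: contraTneq lp => ->; rewrite mulr0 ltxx.
by rewrite -(pmulr_rgt0 _ lp) e pmulr_rgt0.
Qed.

End Peak.
End Candidates.

(** * The program *)

Lemma all_iota_ord (f : nat -> bool) N :
  all f (iota 0 N) = [forall i : 'I_N, f i].
Proof.
apply/allP/forallP => [af i|af i]; first by apply: af; rewrite mem_iota ltn_ord.
by rewrite mem_iota => /andP[_ iN]; exact: (af (Ordinal iN)).
Qed.

(** Natural array 3 holds the verdict on the current peak and arrays 4 to 11 hold
loop counters.  Real arrays 7 to 14 hold scores, gains, [steepness], [decay],
weights, sides and a running sum, in the cells read by the expressions [r_*]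
below; 10 is left out. *)
Definition accepted : nexpr := NRead 3 (NConst 0) (NConst 0).

Definition add_to (k : nat) (e : rexpr) : prog :=
  PReal k (NConst 0) (NConst 0) (RAdd (RRead k (NConst 0) (NConst 0)) e).

Definition sum_into (e : rexpr) : prog :=
  PSeq (PReal 14 (NConst 0) (NConst 0) (RConst 0)) (PFor 5 0 0 (add_to 14 e)).

Definition reject_unless (b : bexpr) : prog :=
  PIf b PSkip (PNat 3 (NConst 0) (NConst 0) (NConst 0)).

Definition n_rounds : nexpr := NRead 0 (NConst 0) (NConst 1).
Definition n_row : nexpr := counter 4.
Definition n_col : nexpr := counter 5.
Definition n_row2 : nexpr := counter 6.
Definition n_base : nexpr := counter 9.
Definition n_coord : nexpr := counter 10.
Definition n_other : nexpr := counter 11.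

Definition r_bound : rexpr := RRead 0 (NConst 0) n_col.
Definition r_normal : rexpr := RRead 1 n_row n_col.
Definition r_answer (i : nexpr) : rexpr := RRead 3 i n_col.
Definition r_score : rexpr := RRead 7 n_row (NConst 0).
Definition r_gain : rexpr := RRead 8 n_row n_row2.
Definition r_steepness : rexpr := RRead 9 (NConst 0) (NConst 0).
Definition r_decay : rexpr := RRead 11 (NConst 0) (NConst 0).
Definition r_weight (i : nexpr) : rexpr := RRead 12 i (NConst 0).
Definition r_side : rexpr := RRead 13 n_row (NConst 0).
Definition r_sum : rexpr := RRead 14 (NConst 0) (NConst 0).
Definition r_slack : rexpr :=
  RMul r_normal (RSub (r_answer n_rounds) (r_answer n_row)).

Definition check_box : prog :=
  PFor 5 0 0 (reject_unless
    (BAnd (RLe (RConst 0) (r_answer n_rounds)) (RLe (r_answer n_rounds) r_bound))).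

Definition compute_scores : prog :=
  PFor 4 1 1 (PSeq (sum_into r_slack) (PReal 7 n_row (NConst 0) r_sum)).

Definition check_orthants : prog :=
  PFor 4 1 0 (PFor 5 0 0 (reject_unless
    (BNot (BAnd (BNot (RLe (RMul r_slack r_slack) (RConst 0)))
                (RLe (RMul r_score r_slack) (RConst 0)))))).

Definition r_gain_term : rexpr :=
  RMul (RMul r_score r_normal) (RSub (r_answer n_row2) (r_answer n_row)).

Definition compute_gain : prog :=
  PSeq (sum_into r_gain_term) (PReal 8 n_row n_row2 r_sum).

Definition compute_gains : prog := PFor 4 1 1 (PFor 6 1 1 compute_gain).

Definition compute_steepness : prog :=
  PSeq (PReal 9 (NConst 0) (NConst 0) (RConst 1))
    (PFor 4 1 1 (PFor 6 1 1 (PIf (RLe r_gain (RConst 0))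
       (add_to 9 (RSub (RConst 0) r_gain))
       (add_to 9 (RDiv (RConst 1) r_gain))))).

Definition compute_decay : prog :=
  PReal 11 (NConst 0) (NConst 0)
    (RDiv (RConst 1) (RAdd (RConst 1) (RMul r_steepness r_steepness))).

Definition lower_weight (e : rexpr) : prog :=
  PIf (RLe (r_weight n_row) e) PSkip (PReal 12 n_row (NConst 0) e).

Definition relax : prog :=
  PIf (BNot (RLe (RConst 0) r_gain)) (lower_weight (RMul r_decay (r_weight n_row2)))
    (PIf (RLe r_gain (RConst 0)) (lower_weight (r_weight n_row2)) PSkip).

Definition compute_weights : prog :=
  PSeq (PFor 4 1 1 (PReal 12 n_row (NConst 0) (RConst 1)))
    (PFor 7 1 1 (PFor 8 1 1 (PFor 4 1 1 (PFor 6 1 1 relax)))).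

Definition check_consistency : prog :=
  PFor 4 1 1 (PFor 6 1 1 (reject_unless
    (RLe (RSub (RConst 0) (r_weight n_row2))
       (RAdd (RSub (RConst 0) (r_weight n_row))
          (RMul (RMul r_steepness (r_weight n_row)) r_gain))))).

Definition write_piece : prog :=
  PSeq (PIf (BAnd (RLe r_score (RConst 0)) (RLe (RConst 0) r_score))
          (PNat 1 n_row (NConst 0) (NConst 0)) (PNat 1 n_row (NConst 0) (NConst 1)))
  (PSeq (PIf (RLe (RConst 0) r_score)
           (PSeq (PNat 2 n_row (NConst 0) (NConst 1))
              (PReal 6 n_row (NConst 0)
                 (RMul (RMul r_steepness (r_weight n_row)) r_score)))
           (PSeq (PNat 2 n_row (NConst 0) (NConst 0))
              (PReal 6 n_row (NConst 0)
                 (RMul (RMul r_steepness (r_weight n_row))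
                    (RSub (RConst 0) r_score)))))
   (PReal 5 n_row (NConst 0) (RSub (RConst 0) (r_weight n_row)))).

Definition write_utility : prog :=
  PSeq (PReal 4 (NConst 0) (NConst 0) (RSub (RConst 0) (r_weight n_rounds)))
    (PFor 4 1 0 write_piece).

Definition compute_certificate : prog :=
  PSeq (PNat 3 (NConst 0) (NConst 0) (NConst 1))
  (PSeq check_box
  (PSeq compute_scores
  (PSeq check_orthants
  (PSeq compute_gains
  (PSeq compute_steepness
  (PSeq compute_decay
  (PSeq compute_weights
   check_consistency))))))).

Definition try_peak : prog :=
  PSeq compute_certificate (PIf (NLe (NConst 1) accepted) write_utility PSkip).

(** The peak under test overwrites row [n] of the array of answers. *)
Definition place : prog :=
  PSeq (PFor 5 0 0 (PReal 3 n_rounds n_col (r_answer n_base)))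
    (PReal 3 n_rounds n_coord (RRead 3 n_other n_coord)).

Definition refine_side : prog :=
  PIf (BAnd (RLe r_side (RConst 0)) (RLe (RConst 0) r_side))
    (PReal 13 n_row (NConst 0) r_slack) PSkip.

Definition compute_sides : prog :=
  PFor 4 1 0 (PSeq (PReal 13 n_row (NConst 0) (RConst 0))
    (PFor 5 0 0 refine_side)).

Definition raise_corner : prog :=
  PIf (BAnd (BNot (RLe (RMul r_side r_normal) (RConst 0)))
            (BNot (RLe (r_answer n_row) (r_answer n_rounds))))
    (PReal 3 n_rounds n_col (r_answer n_row)) PSkip.

Definition move_to_corner : prog :=
  PFor 5 0 0 (PSeq (PReal 3 n_rounds n_col (RConst 0))
    (PFor 4 1 0 raise_corner)).

Definition try_candidate : prog :=
  PSeq place (PSeq try_peak (PSeq compute_sides (PSeq move_to_corner try_peak))).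

(** Inclusive ranges: base [n] makes the loop body run when there are no answers,
coordinate [m] leaves the placed answer as it is, and row [n + 1] is 0. *)
Definition search : prog :=
  PFor 9 1 1 (PFor 10 0 1 (PFor 11 1 2 try_candidate)).

Arguments run : simpl never.

Section Loops.
Variable R : realType.
Implicit Types s t : state R.

Lemma run_seq c1 c2 s : run (PSeq c1 c2) s = run c2 (run c1 s).
Proof. by []. Qed.

Lemma run_nat k e1 e2 e s : run (PNat k e1 e2 e) s =
  State (update (nmem s) k (neval s e1) (neval s e2) (neval s e)) (rmem s).
Proof. by []. Qed.

Lemma run_real k e1 e2 e s : run (PReal k e1 e2 e) s =
  State (nmem s) (update (rmem s) k (neval s e1) (neval s e2) (reval s e)).
Proof. by []. Qed.

Lemma run_if b c1 c2 s :
  run (PIf b c1 c2) s = if beval s b then run c1 s else run c2 s.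
Proof. by []. Qed.

Lemma run_for_sum v x y c s k (f : nat -> R) :
    well_formed (PFor v x y c) ->
    (forall i t, (i < nmem s 0 0 x + y)%N -> unwritten (PFor v x y c) s t ->
       nmem t v 0 0 = i -> rmem (run c t) k 0 0 = rmem t k 0 0 + f i) ->
  rmem (run (PFor v x y c) s) k 0 0 =
  rmem s k 0 0 + \sum_(i < nmem s 0 0 x + y) f i.
Proof.
move=> wf step.
pose P i t := rmem t k 0 0 = rmem s k 0 0 + \sum_(j < i) f j.
apply: (for_ind (P := P)) => // [|i t li un ti Pi].
  by rewrite /P big_ord0 addr0.
by rewrite /P (step i)// Pi big_ord_recr/= addrA.
Qed.

Definition flag s : bool := nmem s 3 0 0 != 0%N.

Lemma run_for_flag v x y c s (f : nat -> bool) :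
    well_formed (PFor v x y c) -> v != 3 ->
    (forall i t, (i < nmem s 0 0 x + y)%N -> unwritten (PFor v x y c) s t ->
       nmem t v 0 0 = i -> flag (run c t) = flag t && f i) ->
  flag (run (PFor v x y c) s) =
  flag s && [forall i : 'I_(nmem s 0 0 x + y), f i].
Proof.
move=> wf v3 step; rewrite -all_iota_ord.
pose P i t := flag t = flag s && all f (iota 0 i).
have set_flag z t : flag (set_counter v z t) = flag t.
  by rewrite /flag /= update_other// eq_sym.
apply: (for_ind (P := P)) => // [|i t z|i t li un ti Pi].
- by rewrite /P set_flag andbT.
- by rewrite /P set_flag.
- by rewrite /P (step i)// Pi -addn1 iotaD all_cat /= andbT andbA.
Qed.

Lemma run_sum_into e s (f : nat -> R) :
    (forall j t, (j < nmem s 0 0 0)%N ->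
       (forall k, k != 5 -> nmem t k = nmem s k) ->
       (forall k, k != 14 -> rmem t k = rmem s k) ->
       nmem t 5 0 0 = j -> reval t e = f j) ->
  rmem (run (sum_into e) s) 14 0 0 = \sum_(j < nmem s 0 0 0) f j.
Proof.
move=> ev; rewrite /sum_into run_seq.
rewrite (@run_for_sum 5 0 0 _ _ 14 f)//; first by rewrite run_real /= updateE /= add0r addn0.
move=> j t; rewrite ?addn0 => lj [un ur] tj; rewrite run_real /= updateE /=.
congr (_ + _); apply: ev => // k k5.
  by rewrite un// inE.
by rewrite ur ?inE// run_real /= update_other.
Qed.

End Loops.

(** * The program performs the test *)

Section Pieces.
Variable R : realType.
Implicit Types s t : state R.

Local Notation m_ s := (nmem s 0 0 0).
Local Notation n_ s := (nmem s 0 0 1).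

Lemma run_reject b s : flag (run (reject_unless b) s) = flag s && beval s b.
Proof.
rewrite run_if; case: ifP => _; first by rewrite andbT.
by rewrite run_nat /flag /= andbF.
Qed.

Lemma run_check_box s : flag (run check_box s) =
  flag s && in_box (m_ s) (n_ s) (rmem s 0 0) (rmem s 3).
Proof.
rewrite /check_box (@run_for_flag _ _ _ _ _ _
  (fun j => (0 <= rmem s 3 (n_ s) j) && (rmem s 3 (n_ s) j <= rmem s 0 0 j)))//.
  by rewrite addn0.
by move=> j t lj [un ur] tj; rewrite run_reject /= tj !un// !ur.
Qed.

Lemma run_scores s i : (i < n_ s + 1)%N ->
  rmem (run compute_scores s) 7 i 0 = score (m_ s) (n_ s) (rmem s 1) (rmem s 3) i.
Proof.
move: i; rewrite /compute_scores.
pose P i t := forall i', (i' < i)%N ->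
  rmem t 7 i' 0 = score (m_ s) (n_ s) (rmem s 1) (rmem s 3) i'.
apply: (for_ind (P := P)) => // i t li [un ur] ti Pi i' li'.
rewrite run_seq run_real /= updateE /= nmem_run// ti andbT.
have [->|ne] := eqVneq i' i.
  rewrite (@run_sum_into _ _ _ (fun j =>
    rmem s 1 i j * (rmem s 3 (n_ s) j - rmem s 3 i j))) ?un//.
  by move=> j u lj nu ru uj; rewrite /= uj !nu// !ru// ti !un// !ur.
by rewrite rmem_run// Pi// ltn_neqAle ne.
Qed.

Lemma run_check_orthants s :
  (forall i, (i < n_ s + 1)%N ->
     rmem s 7 i 0 = score (m_ s) (n_ s) (rmem s 1) (rmem s 3) i) ->
  flag (run check_orthants s) =
  flag s && in_orthants (m_ s) (n_ s) (rmem s 1) (rmem s 3).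
Proof.
move=> sc; rewrite /check_orthants (@run_for_flag _ _ _ _ _ _ (fun i =>
  [forall j : 'I_(m_ s), let t := rmem s 1 i j * (rmem s 3 (n_ s) j - rmem s 3 i j) in
   (t * t <= 0) || (0 < rmem s 7 i 0 * t)]))//.
  rewrite addn0; congr (_ && _); apply: eq_forallb => i.
  by rewrite sc// ltn_addr.
move=> i t li [un ur] ti; rewrite (@run_for_flag _ _ _ _ _ _ (fun j =>
  let t := rmem s 1 i j * (rmem s 3 (n_ s) j - rmem s 3 i j) in
   (t * t <= 0) || (0 < rmem s 7 i 0 * t)))//.
  by rewrite addn0 un.
move=> j u lj [nu ru] uj; rewrite run_reject /= uj !nu// !ru// ti !un// !ur//.
by rewrite negb_and negbK -ltNge.
Qed.

Lemma run_gains s :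
  (forall i, (i < n_ s + 1)%N ->
     rmem s 7 i 0 = score (m_ s) (n_ s) (rmem s 1) (rmem s 3) i) ->
  forall i k, (i < n_ s + 1)%N -> (k < n_ s + 1)%N ->
  rmem (run compute_gains s) 8 i k =
  gain (m_ s) (n_ s) (rmem s 1) (rmem s 3) i k.
Proof.
set g := gain _ _ _ _ => sc.
suff : forall i, (i < n_ s + 1)%N -> forall k, (k < n_ s + 1)%N ->
   rmem (run compute_gains s) 8 i k = g i k by move=> gE i k /gE; apply.
pose P i t := forall i', (i' < i)%N -> forall k, (k < n_ s + 1)%N ->
  rmem t 8 i' k = g i' k.
apply: (for_ind (P := P)) => // i t li [un ur] ti Pi.
pose Q k u := P i u /\ forall k', (k' < k)%N -> rmem u 8 i k' = g i k'.
suff [Pi' Qi] : Q (nmem t 0 0 1 + 1)%N (run (PFor 6 1 1 compute_gain) t).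
  move=> i'; rewrite ltnS leq_eqVlt => /orP[/eqP -> k lk|/Pi'//].
  by apply: Qi; rewrite un.
apply: (for_ind (P := Q)) => // k u; rewrite un// => lk [nu ru] uk [Pu Qu].
have sumE : rmem (run (sum_into r_gain_term) u) 14 0 0 = g i k.
  rewrite (@run_sum_into _ _ _ (fun j =>
     score (m_ s) (n_ s) (rmem s 1) (rmem s 3) i *
     rmem s 1 i j * (rmem s 3 k j - rmem s 3 i j))) ?nu ?un//.
  move=> j v lj nv rv vj.
  by rewrite /= vj !nv// uk !rv// !nu// ti !ru// !ur// sc.
have cells i' k' : rmem (run compute_gain u) 8 i' k' =
    if (i' == i) && (k' == k) then g i k else rmem u 8 i' k'.
  rewrite /compute_gain run_seq run_real /= updateE /=.
  rewrite !(@nmem_run _ (sum_into _))// uk nu// ti sumE.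
  by case: ifP => // _; rewrite rmem_run.
split=> [i' li' k' lk'|k' lk']; rewrite cells.
  by rewrite (ltn_eqF li') Pu.
rewrite eqxx /=; have [->//|ne] := eqVneq k' k.
by rewrite Qu// ltn_neqAle ne.
Qed.

Lemma run_steepness s (g : nat -> nat -> R) :
  (forall i k, (i < n_ s + 1)%N -> (k < n_ s + 1)%N -> rmem s 8 i k = g i k) ->
  rmem (run compute_steepness s) 9 0 0 =
  1 + \sum_(i < n_ s + 1) \sum_(k < n_ s + 1)
        if g i k <= 0 then 0 - g i k else 1 / g i k.
Proof.
move=> gE; rewrite /compute_steepness run_seq.
rewrite (@run_for_sum _ _ _ _ _ _ _ (fun i => \sum_(k < n_ s + 1)
  if g i k <= 0 then 0 - g i k else 1 / g i k))//.
move=> i t li [un ur] ti.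
rewrite (@run_for_sum _ _ _ _ _ _ _ (fun k =>
  if g i k <= 0 then 0 - g i k else 1 / g i k))//; first by rewrite un.
move=> k u lk [nu ru] uk.
have gik : rmem u 8 i k = g i k.
  by rewrite ru// ur// rmem_run// gE//; move: lk; rewrite un.
rewrite run_if /= uk nu// ti gik.
by case: ifP => _; rewrite run_real /= updateE /= uk nu// ti gik.
Qed.

Definition weights_are (N : nat) (p : nat -> R) t : Prop :=
  forall x, (x < N)%N -> rmem t 12 x 0 = p x.

Lemma run_lower_weight e s i N p : (i < N)%N -> nmem s 4 0 0 = i ->
  weights_are N p s ->
  weights_are N (fun x => if x == i then Num.min (p i) (reval s e) else p x)
    (run (lower_weight e) s).
Proof.
move=> iN si ps x xN; rewrite run_if /= si minEle -(ps i iN) -(ps x xN).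
case: ifP => _; first by case: eqP => // ->.
by rewrite run_real /= updateE /= si andbT.
Qed.

Lemma run_for_weights v x y c s N (f : nat -> (nat -> R) -> nat -> R) p :
    well_formed (PFor v x y c) ->
    (forall i t r, (i < nmem s 0 0 x + y)%N -> unwritten (PFor v x y c) s t ->
       nmem t v 0 0 = i -> weights_are N r t ->
       weights_are N (f i r) (run c t)) ->
  weights_are N p s ->
  weights_are N (iteri (nmem s 0 0 x + y) f p) (run (PFor v x y c) s).
Proof.
move=> wf step ps.
apply: (for_ind (P := fun i => weights_are N (iteri i f p))) => // i t li un ti pt.
exact: (step i).
Qed.

Section Weights.
Variables (m n : nat) (a q : nat -> nat -> R).

Definition gains_ready t : Prop :=
  [/\ n_ t = n, rmem t 11 0 0 = decay m n a q &
      forall i k, (i < n + 1)%N -> (k < n + 1)%N ->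
        rmem t 8 i k = gain m n a q i k].

Lemma gains_ready_unwritten c t u : 0 \notin nat_written c ->
  8 \notin real_written c -> 11 \notin real_written c ->
  unwritten c t u -> gains_ready t -> gains_ready u.
Proof.
move=> c0 c8 c11 [un ur] [tn t11 t8].
by rewrite /gains_ready un// !ur.
Qed.

Lemma run_relax t i k p : gains_ready t -> (i < n + 1)%N -> (k < n + 1)%N ->
  nmem t 4 0 0 = i -> nmem t 6 0 0 = k -> weights_are (n + 1) p t ->
  weights_are (n + 1) (relaxed m n a q i k p) (run relax t).
Proof.
move=> [tn t11 t8] li lk ti tk pt; rewrite run_if /= ti tk t8// -ltNge /relaxed.
case: ifP => _.
  have := run_lower_weight (RMul r_decay (r_weight n_row2)) li ti pt.
  by rewrite /= t11 tk (pt k lk).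
rewrite run_if /= ti tk t8//; case: ifP => _.
  have := run_lower_weight (r_weight n_row2) li ti pt.
  by rewrite /= tk (pt k lk).
by move=> x lx; rewrite pt//; case: eqP => // ->.
Qed.

Lemma run_weights t : gains_ready t ->
  weights_are (n + 1) (weights m n a q) (run compute_weights t).
Proof.
move=> gt; rewrite /compute_weights run_seq.
have : gains_ready (run (PFor 4 1 1 (PReal 12 n_row (NConst 0) (RConst 1))) t).
  by case: gt => tn t11 t8; rewrite /gains_ready nmem_run// !rmem_run.
have : weights_are (n + 1) (fun=> 1)
    (run (PFor 4 1 1 (PReal 12 n_row (NConst 0) (RConst 1))) t).
  case: gt => <- _ _.
  pose P i t := forall x, (x < i)%N -> rmem t 12 x 0 = 1 :> R.
  apply: (for_ind (P := P)) => // i u li [un ur] ui Pi x lx.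
  rewrite run_real /= updateE /= ui andbT; have [//|ne] := eqVneq x i.
  by rewrite Pi// ltn_neqAle ne.
move: (run _ _) => {gt}t t1 gt; have nt : n_ t = n by case: gt.
have sweepP : forall u p, gains_ready u -> weights_are (n + 1) p u ->
   weights_are (n + 1) (sweep m n a q p) (run (PFor 4 1 1 (PFor 6 1 1 relax)) u).
  move=> u p gu pu; have nu : n_ u = n by case: gu.
  rewrite /sweep -nu; apply: run_for_weights => //; last by rewrite nu.
  move=> i v r li uv vi pv; have gv : gains_ready v by apply: gains_ready_unwritten uv gu.
  have nv : n_ v = n by case: gv.
  rewrite nu -nv; apply: run_for_weights => //; last by rewrite nv -nu.
  rewrite nu in li; move=> k w r' lk vw wk pw.
  have gw : gains_ready w by apply: gains_ready_unwritten vw gv.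
  rewrite nv in lk pw *; apply: run_relax => //.
  by case: vw => ->.
have iterE l (f : (nat -> R) -> nat -> R) p : iter l f p = iteri l (fun=> f) p.
  by elim: l => //= l ->.
rewrite /weights iterE -{2}nt; apply: run_for_weights => // i u p li tu ui pu.
have gu : gains_ready u by apply: gains_ready_unwritten tu gt.
have nu : n_ u = n by case: gu.
rewrite iterE -{2}nu; apply: run_for_weights => // r v p' lr uv vr pv.
apply: sweepP => //.
exact: gains_ready_unwritten uv gu.
Qed.

End Weights.

End Pieces.

Section Test.
Variable R : realType.
Implicit Types s t : state R.

Local Notation m_ s := (nmem s 0 0 0).
Local Notation n_ s := (nmem s 0 0 1).

Lemma run_check_consistency s :
  (forall i, (i < n_ s + 1)%N ->
     rmem s 12 i 0 = weights (m_ s) (n_ s) (rmem s 1) (rmem s 3) i) ->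
  rmem s 9 0 0 = steepness (m_ s) (n_ s) (rmem s 1) (rmem s 3) ->
  (forall i k, (i < n_ s + 1)%N -> (k < n_ s + 1)%N ->
     rmem s 8 i k = gain (m_ s) (n_ s) (rmem s 1) (rmem s 3) i k) ->
  flag (run check_consistency s) =
  flag s && consistent (m_ s) (n_ s) (rmem s 1) (rmem s 3)
              (weights (m_ s) (n_ s) (rmem s 1) (rmem s 3)).
Proof.
set w := weights _ _ _ _; set V := steepness _ _ _ _ => wE VE gE.
rewrite /check_consistency (@run_for_flag _ _ _ _ _ _ (fun i =>
  [forall k : 'I_(n_ s + 1), 0 - w k <= 0 - w i + V * w i *
     gain (m_ s) (n_ s) (rmem s 1) (rmem s 3) i k]))//.
move=> i t li [un ur] ti; rewrite (@run_for_flag _ _ _ _ _ _ (fun k =>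
  0 - w k <= 0 - w i + V * w i *
     gain (m_ s) (n_ s) (rmem s 1) (rmem s 3) i k))//.
  by rewrite un.
move=> k u lk [nu ru] uk; rewrite un// in lk.
by rewrite run_reject /= uk !nu// !ru// ti !ur// VE !wE// gE.
Qed.

Lemma run_write_piece s i : nmem s 4 0 0 = i ->
  let sc := rmem s 7 i 0 in
  run write_piece s =
  State (update (update (nmem s) 1 i 0 (sc != 0)) 2 i 0 (0 <= sc))
    (update (update (rmem s) 6 i 0 (rmem s 9 0 0 * rmem s 12 i 0 * `|sc|))
       5 i 0 (0 - rmem s 12 i 0)).
Proof.
move=> si; rewrite /write_piece run_seq run_if /= si -eq_le.
have [e|ne] := eqVneq (rmem s 7 i 0) 0.
  rewrite run_nat run_seq run_if /= updateE /= si e lexx run_seq run_nat !run_real.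
  by rewrite /= !updateE /= si e normr0.
rewrite run_nat run_seq run_if /= updateE /= si.
case: (leP 0 (rmem s 7 i 0)) => sg; rewrite run_seq run_nat !run_real /= !updateE /= si.
  by rewrite ger0_norm.
by rewrite ltr0_norm// [0 - rmem s 7 i 0]sub0r.
Qed.

Lemma run_write_utility s (sc w : nat -> R) V :
  (forall i, (i < n_ s)%N -> rmem s 7 i 0 = sc i) ->
  (forall i, (i < n_ s + 1)%N -> rmem s 12 i 0 = w i) -> rmem s 9 0 0 = V ->
  let s' := run write_utility s in
  rmem s' 4 0 0 = - w (n_ s) /\
  forall i, (i < n_ s)%N ->
  [/\ (nmem s' 1 i 0 != 0%N) = (sc i != 0), (nmem s' 2 i 0 != 0%N) = (0 <= sc i),
      rmem s' 5 i 0 = - w i & rmem s' 6 i 0 = V * w i * `|sc i| ].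
Proof.
move=> scE wE VE /=; rewrite /write_utility run_seq.
split.
  by rewrite rmem_run// run_real /= updateE /= sub0r wE// addn1.
set s1 := run _ s.
pose P i t := forall i', (i' < i)%N ->
  [/\ (nmem t 1 i' 0 != 0%N) = (sc i' != 0), (nmem t 2 i' 0 != 0%N) = (0 <= sc i'),
      rmem t 5 i' 0 = - w i' & rmem t 6 i' 0 = V * w i' * `|sc i'| ].
suff : P (n_ s1 + 0)%N (run (PFor 4 1 0 write_piece) s1) by rewrite addn0.
apply: (for_ind (P := P)) => // i t; rewrite addn0 => li [un ur] ti Pi i' li'.
rewrite (run_write_piece ti) /= !updateE /= !andbT.
have [->|ne] := eqVneq i' i; last by apply: Pi; rewrite ltn_neqAle ne.
rewrite !ur// !rmem_run// scE// wE ?ltn_addr// VE sub0r.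
by split; rewrite ?eqb0 ?negbK.
Qed.

Lemma run_compute_certificate s :
  let s' := run compute_certificate s in
  let n := n_ s in let m := m_ s in let a := rmem s 1 in let q := rmem s 3 in
  [/\ flag s' = certified m n (rmem s 0 0) a q,
      forall i, (i < n + 1)%N -> rmem s' 7 i 0 = score m n a q i,
      rmem s' 9 0 0 = steepness m n a q
    & forall i, (i < n + 1)%N -> rmem s' 12 i 0 = weights m n a q i].
Proof.
move=> s' n m a q; rewrite {}/s' {}/n {}/m {}/a {}/q /compute_certificate.
rewrite run_seq; set s0 := run (PNat _ _ _ _) s.
have f0 : flag s0 by rewrite /s0 run_nat.
have N0 : nmem s0 0 = nmem s 0 by rewrite nmem_run.
have R0 k : rmem s0 k = rmem s k by rewrite rmem_run.
rewrite run_seq; set s1 := run check_box s0.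
have f1 : flag s1 = in_box (m_ s) (n_ s) (rmem s 0 0) (rmem s 3).
  by rewrite run_check_box f0 N0 !R0.
have N1 : nmem s1 0 = nmem s 0 by rewrite nmem_run.
have R1 k : rmem s1 k = rmem s k by rewrite rmem_run// R0.
rewrite run_seq; set s2 := run compute_scores s1.
have f2 : flag s2 = flag s1 by rewrite /flag nmem_run.
have N2 : nmem s2 0 = nmem s 0 by rewrite nmem_run.
have [R20 R21 R23] : [/\ rmem s2 0 = rmem s 0, rmem s2 1 = rmem s 1 & rmem s2 3 = rmem s 3].
  by rewrite !rmem_run.
have S2 i : (i < n_ s + 1)%N -> rmem s2 7 i 0 = score (m_ s) (n_ s) (rmem s 1) (rmem s 3) i.
  by move=> li; rewrite run_scores ?N1 ?R1.
rewrite run_seq; set s3 := run check_orthants s2.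
have f3 : flag s3 = flag s1 && in_orthants (m_ s) (n_ s) (rmem s 1) (rmem s 3).
  by rewrite run_check_orthants ?f2 N2 R21 R23.
have N3 : nmem s3 0 = nmem s 0 by rewrite nmem_run.
have R3 k : rmem s3 k = rmem s2 k by rewrite rmem_run.
rewrite run_seq; set s4 := run compute_gains s3.
have G4 i k : (i < n_ s + 1)%N -> (k < n_ s + 1)%N ->
    rmem s4 8 i k = gain (m_ s) (n_ s) (rmem s 1) (rmem s 3) i k.
  have := @run_gains _ s3; rewrite N3 !R3 R21 R23; apply.
  by move=> i' li'; rewrite S2.
have N4 : nmem s4 0 = nmem s 0 by rewrite nmem_run.
rewrite run_seq; set s5 := run compute_steepness s4.
have V5 : rmem s5 9 0 0 = steepness (m_ s) (n_ s) (rmem s 1) (rmem s 3).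
  by rewrite (run_steepness (g := gain (m_ s) (n_ s) (rmem s 1) (rmem s 3))) N4.
have N5 : nmem s5 0 = nmem s 0 by rewrite nmem_run.
rewrite run_seq; set s6 := run compute_decay s5.
have D6 : rmem s6 11 0 0 = decay (m_ s) (n_ s) (rmem s 1) (rmem s 3).
  by rewrite /s6 /decay -V5; clearbody s5; rewrite run_real /= updateE.
have N6 : nmem s6 0 = nmem s 0 by rewrite nmem_run.
have G6 : gains_ready (m_ s) (n_ s) (rmem s 1) (rmem s 3) s6.
  split; rewrite ?N6// => i k li lk.
  by rewrite rmem_run// rmem_run// G4.
rewrite run_seq; set s7 := run compute_weights s6.
have W7 := run_weights G6.
have N7 : nmem s7 0 = nmem s 0 by rewrite nmem_run.
have f7 : flag s7 = flag s3.
  by rewrite /flag nmem_run// nmem_run// nmem_run// nmem_run.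
have [R70 R71 R73 R77] : [/\ rmem s7 0 = rmem s 0, rmem s7 1 = rmem s 1,
    rmem s7 3 = rmem s 3 & rmem s7 7 = rmem s2 7].
  split; do 5 rewrite rmem_run//; rewrite ?R20 ?R21 ?R23//.
have V7 : rmem s7 9 = rmem s5 9 by rewrite rmem_run// rmem_run.
split.
- rewrite run_check_consistency N7 ?R70 R71 R73 ?V7//.
    by rewrite f7 f3 f1 /certified andbA.
  by move=> i k li lk; rewrite rmem_run//; case: G6 => _ _ ->.
- by move=> i li; rewrite rmem_run// R77 S2.
- by rewrite rmem_run// V7.
- by move=> i li; rewrite rmem_run// W7.
Qed.

Lemma run_try_peak s :
  if certified (m_ s) (n_ s) (rmem s 0 0) (rmem s 1) (rmem s 3) then
    certified_parameters (m_ s) (rmem s 1) (rmem s 3)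
      (output (n_ s) (run try_peak s))
  else output (n_ s) (run try_peak s) = output (n_ s) s.
Proof.
have [fE SE VE WE] := run_compute_certificate s.
rewrite /try_peak run_seq.
have out : output (n_ s) (run compute_certificate s) = output (n_ s) s.
  by rewrite /output !nmem_run// !rmem_run.
have N1 : nmem (run compute_certificate s) 0 = nmem s 0 by rewrite nmem_run.
move: (run compute_certificate s) fE SE VE WE out N1 => t fE SE VE WE out N1.
have tE : beval t (NLe (NConst 1) accepted) = flag t by rewrite /flag /= lt0n.
rewrite run_if tE fE; case: ifP => c; rewrite c; last exact: out.
have := @run_write_utility t (score (m_ s) (n_ s) (rmem s 1) (rmem s 3))
  (weights (m_ s) (n_ s) (rmem s 1) (rmem s 3)) (steepness (m_ s) (n_ s) (rmem s 1) (rmem s 3)).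
rewrite N1 => /(_ (fun i li => SE i (ltn_addr 1 li)) WE VE) [topE cellE].
by split=> [i|i||i|i] /=; rewrite ?inE; try by have [] := cellE i (ltn_ord i).
Qed.

End Test.

(** * The program enumerates the candidates *)

Section Candidate.
Variable R : realType.
Implicit Types s t : state R.

Local Notation m_ s := (nmem s 0 0 0).
Local Notation n_ s := (nmem s 0 0 1).

Lemma run_place_rows s i j : i != n_ s ->
  rmem (run place s) 3 i j = rmem s 3 i j.
Proof.
move=> ni; rewrite /place run_seq run_real /= updateE /= nmem_run// (negPf ni) /=.
apply: (for_ind (P := fun _ t => rmem t 3 i j = rmem s 3 i j)) => // k t lk [un ur] tk Pt.
by rewrite run_real /= updateE /= un// (negPf ni).
Qed.

Lemma run_place s j : let b := nmem s 9 0 0 in let o := nmem s 11 0 0 in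
  b != n_ s -> o != n_ s -> (j < m_ s)%N ->
  rmem (run place s) 3 (n_ s) j = placed (rmem s 3) b (nmem s 10 0 0) o j.
Proof.
move=> b o bn on jm; rewrite /place run_seq; set s1 := run _ s.
pose P l t := (forall i j', i != n_ s -> rmem t 3 i j' = rmem s 3 i j') /\
  (forall j', (j' < l)%N -> rmem t 3 (n_ s) j' = rmem s 3 b j').
have [rows rown] : P (m_ s + 0)%N s1.
  apply: (for_ind (P := P)) => // l t ll [un ur] tl [Pi Pn].
  split=> [i j' ni|j' lj']; rewrite run_real /= updateE /= tl !un//.
    by rewrite (negPf ni) /= Pi.
  rewrite eqxx Pi//; have [->//|ne] := eqVneq j' l.
  by rewrite Pn// ltn_neqAle ne.
rewrite run_real /= updateE /= !nmem_run// eqxx /placed.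
by case: eqP => [->|_]; [rewrite rows|rewrite rown// addn0].
Qed.

Lemma run_compute_sides s i : (i < n_ s)%N ->
  rmem (run compute_sides s) 13 i 0 = side (m_ s) (n_ s) (rmem s 1) (rmem s 3) i.
Proof.
pose P i t := forall i', (i' < i)%N ->
  rmem t 13 i' 0 = side (m_ s) (n_ s) (rmem s 1) (rmem s 3) i'.
suff : P (n_ s + 0)%N (run compute_sides s) by rewrite addn0; apply.
apply: (for_ind (P := P)) => // {}i t li [un ur] ti Pi.
rewrite run_seq; set t1 := run _ t.
pose d j := rmem s 1 i j * (rmem s 3 (n_ s) j - rmem s 3 i j).
pose Q l u := rmem u 13 i 0 = iteri l (fun j x => if x == 0 then d j else x) 0 /\
  (forall i', (i' < i)%N -> rmem u 13 i' 0 = rmem t 13 i' 0).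
have [Qi Qo] : Q (m_ t1 + 0)%N (run (PFor 5 0 0 refine_side) t1).
  apply: (for_ind (P := Q)) => //.
    split=> [|i' li']; rewrite /= /t1 /= updateE /= ti ?eqxx//.
    by rewrite (ltn_eqF li').
  move=> j u lj [nu ru] uj [Qi Qo].
  have ui : nmem u 4 0 0 = i by rewrite nu// nmem_run.
  rewrite /Q run_if /= ui -eq_le Qi; case: ifP => x0; last by split.
  rewrite run_real /=; split=> [|i' li']; rewrite updateE /= ui.
    by rewrite eqxx /= uj !nu// !ru// nmem_run// !rmem_run// !un// !ur.
  by rewrite (ltn_eqF li') Qo.
move=> i'; rewrite ltnS leq_eqVlt => /orP[/eqP ->|li'].
  by rewrite Qi addn0 nmem_run// un.
by rewrite Qo// Pi.
Qed.

Lemma run_move_to_corner s :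
  (forall i, (i < n_ s)%N ->
     rmem s 13 i 0 = side (m_ s) (n_ s) (rmem s 1) (rmem s 3) i) ->
  (forall i j, i != n_ s ->
     rmem (run move_to_corner s) 3 i j = rmem s 3 i j) /\
  (forall j, (j < m_ s)%N -> rmem (run move_to_corner s) 3 (n_ s) j =
     corner (n_ s) (rmem s 1) (side (m_ s) (n_ s) (rmem s 1) (rmem s 3)) (rmem s 3) j).
Proof.
set n := n_ s; set sd := side _ _ _ _ => sE.
pose P l t := (forall i j, i != n -> rmem t 3 i j = rmem s 3 i j) /\
  (forall j, (j < l)%N -> rmem t 3 n j = corner n (rmem s 1) sd (rmem s 3) j).
suff : P (m_ s + 0)%N (run move_to_corner s) by rewrite addn0.
apply: (for_ind (P := P)) => // j t; rewrite addn0 => lj [un ur] tj [Pi Pn].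
rewrite run_seq; set t1 := run _ t.
have n1 : n_ t1 = n by rewrite nmem_run// un.
pose step i x := if (0 < sd i * rmem s 1 i j) && (x < rmem s 3 i j)
  then rmem s 3 i j else x.
pose Q l u := [/\ forall i j', i != n -> rmem u 3 i j' = rmem s 3 i j',
  forall j', (j' < j)%N -> rmem u 3 n j' = corner n (rmem s 1) sd (rmem s 3) j' &
  rmem u 3 n j = iteri l step 0].
have : Q (n_ t1 + 0)%N (run (PFor 4 1 0 raise_corner) t1).
  apply: (for_ind (P := Q)) => //.
    split=> [i j' ni|j' lj'|]; rewrite /= /t1 /= updateE /= tj un// -/n.
    - by rewrite (negPf ni) /= Pi.
    - by rewrite (ltn_eqF lj') andbF Pn.
    - by rewrite !eqxx.
  move=> i u; rewrite addn0 n1 => li [nu ru] ui [Qi Qo Qj].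
  have uj : nmem u 5 0 0 = j by rewrite nu// nmem_run.
  have un' : n_ u = n by rewrite nu.
  have r13 : rmem u 13 i 0 = sd i by rewrite ru// rmem_run// ur// sE.
  have r1 : rmem u 1 = rmem s 1 by rewrite ru// rmem_run// ur.
  have ni : i != n by rewrite (ltn_eqF li).
  rewrite /Q run_if /= ui uj un' r13 r1 -!ltNge Qj (Qi i j ni) /step.
  case: ifP => c; last by split.
  rewrite run_real /=; split=> [i' j' ni'|j' lj'|]; rewrite updateE /= un' uj.
  - by rewrite (negPf ni') /= Qi.
  - by rewrite (ltn_eqF lj') andbF Qo.
  - by rewrite !eqxx /= ui Qi.
rewrite addn0 n1 => -[Qi Qo Qj]; split=> // j'.
by rewrite ltnS leq_eqVlt => /orP[/eqP ->|/Qo].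
Qed.

(** A search succeeds if [G], once true, stays true and some iteration, marked by
[H], makes it true. *)
Lemma for_hit v x y c s (A G : state R -> Prop) (H : nat -> Prop) :
    well_formed (PFor v x y c) ->
    (forall z t, A t -> A (set_counter v z t)) ->
    (forall z t, G t -> G (set_counter v z t)) ->
    (forall i t, (i < nmem s 0 0 x + y)%N -> unwritten (PFor v x y c) s t ->
       nmem t v 0 0 = i -> A t ->
       [/\ A (run c t), G t -> G (run c t) & H i -> G (run c t)]) ->
    A s ->
  [/\ A (run (PFor v x y c) s), G s -> G (run (PFor v x y c) s) &
    (exists2 i, (i < nmem s 0 0 x + y)%N & H i) -> G (run (PFor v x y c) s)].
Proof.
move=> wf stA stG step As.
pose P i t := [/\ A t, G s -> G t & (exists2 j, (j < i)%N & H j) -> G t].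
apply: (for_ind (P := P)) => // [|i t [tA tG tH]|i t li un ti [tA tG tH]].
- by split; [exact: stA|exact: stG|case].
- by split=> [|/tG /stG|/tH /stG]; first exact: stA.
have [sA sG sH] := step i t li un ti tA.
split=> // [/tG|[j]]; first exact: sG.
rewrite ltnS leq_eqVlt => /orP[/eqP ->//|ji Hj].
by apply: sG; apply: tH; exists j.
Qed.

End Candidate.

Section Search.
Variables (R : realType) (m n : nat) (D : dataset R m n).
Implicit Types s t : state R.
Hypothesis surveyD : survey_dataset D.

Let input := input_state D.
Let M := rmem input 0 0.
Let a := rmem input 1.
Let q := rmem input 3.

Lemma cell_ord l (f : 'I_l -> R) (i : 'I_l) : cell f i = f i.
Proof. by rewrite /cell valK. Qed.

Lemma cell_out l (f : 'I_l -> R) i : (l <= i)%N -> cell f i = 0.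
Proof. by move=> li; rewrite /cell insubF// ltnNge li. Qed.

Lemma boundE (j : 'I_m) : M j = bound D 0 j.
Proof. exact: cell_ord. Qed.

Lemma normalE (i : 'I_n) (j : 'I_m) : a i j = normal D i 0 j.
Proof. by rewrite /a /= !cell_ord. Qed.

Lemma answerE (i : 'I_n) (j : 'I_m) : q i j = answer D i 0 j.
Proof. by rewrite /q /= !cell_ord. Qed.

Lemma normal_out i j : (n <= i)%N -> a i j = 0.
Proof. exact: cell_out. Qed.

Lemma answer_out i j : (n <= i)%N -> q i j = 0.
Proof. exact: cell_out. Qed.

Definition data_intact t : Prop :=
  [/\ nmem t 0 = nmem input 0, rmem t 0 0 = M, rmem t 1 = a &
      forall i j, i != n -> rmem t 3 i j = q i j].

Definition output_good t : Prop :=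
  valid_parameters (output n t) /\
  rationalizing_utility D (utility D (output n t)).

Lemma data_intact_run c t :
  0 \notin nat_written c -> 0 \notin real_written c -> 1 \notin real_written c ->
  3 \notin real_written c -> data_intact t -> data_intact (run c t).
Proof.
move=> c0 r0 r1 r3 [t0 tM ta tq].
by split=> [|||i j ni]; rewrite ?(nmem_run _ c0) ?(rmem_run _ r0) ?(rmem_run _ r1)
  ?(rmem_run _ r3) ?tq.
Qed.

Lemma output_good_run c t :
  1 \notin nat_written c -> 2 \notin nat_written c -> 4 \notin real_written c ->
  5 \notin real_written c -> 6 \notin real_written c ->
  output_good t -> output_good (run c t).
Proof.
move=> n1 n2 r4 r5 r6.
by rewrite /output_good /output !(nmem_run _ n1) !(nmem_run _ n2)
  !(rmem_run _ r4) !(rmem_run _ r5) !(rmem_run _ r6).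
Qed.

(** Success is never lost: a peak that fails the test leaves the output as it is,
and one that passes replaces it by another correct output. *)
Lemma try_peak_good t : data_intact t ->
  [/\ data_intact (run try_peak t),
      output_good t -> output_good (run try_peak t) &
      certified m n M a (rmem t 3) -> output_good (run try_peak t)].
Proof.
move=> [t0 tM ta tq]; have := run_try_peak t.
rewrite t0 tM ta /=.
have sound : certified m n M a (rmem t 3) ->
    certified_parameters m a (rmem t 3) (output n (run try_peak t)) ->
    output_good (run try_peak t).
  apply: certified_sound => //; [exact: boundE|exact: normalE| |].
    by move=> i j; rewrite tq ?answerE// ltn_eqF.
  by move=> j; rewrite normal_out.
split.
- exact: data_intact_run.
- move: H; case: ifP => [c o _|_ o]; first exact: sound.
  by rewrite /output_good o.
- by move=> c; move: H; rewrite c; exact: sound.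
Qed.

Lemma try_candidate_good t : data_intact t ->
  [/\ data_intact (run try_candidate t),
      output_good t -> output_good (run try_candidate t) &
      nmem t 11 0 0 != n ->
      winning m n M a q (nmem t 9 0 0) (nmem t 10 0 0) (nmem t 11 0 0) ->
      output_good (run try_candidate t)].
Proof.
move=> td; have [t0 tM ta tq] := td.
have tn : nmem t 0 0 1 = n by rewrite t0.
have tm : nmem t 0 0 0 = m by rewrite t0.
rewrite /try_candidate run_seq; set t1 := run place t.
have d1 : data_intact t1.
  split=> [|||i j ni]; try by rewrite ?nmem_run// rmem_run.
  by rewrite run_place_rows ?tq ?tn.
have g1 : output_good t -> output_good t1 by exact: output_good_run.
rewrite run_seq; set t2 := run try_peak t1.
have [d2 g2 c2] := try_peak_good d1.
have r2 : rmem t2 3 = rmem t1 3 by rewrite rmem_run.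
rewrite run_seq; set t3 := run compute_sides t2.
have d3 : data_intact t3 by exact: data_intact_run.
have g3 : output_good t2 -> output_good t3 by exact: output_good_run.
have N3 : nmem t3 0 = nmem input 0 by case: d3.
have A3 : rmem t3 1 = a by case: d3.
have r3 : rmem t3 3 = rmem t1 3 by rewrite rmem_run.
have [|rows cor] := @run_move_to_corner _ t3.
  have N2 : nmem t2 0 = nmem t3 0 by rewrite [RHS]nmem_run.
  move=> i; rewrite -N2 => li; rewrite run_compute_sides//.
  by rewrite [rmem t3 1]rmem_run// [rmem t3 3]rmem_run.
rewrite run_seq; set t4 := run move_to_corner t3 in rows cor *.
have n3 : nmem t3 0 0 1 = n by rewrite N3.
have m3 : nmem t3 0 0 0 = m by rewrite N3.
rewrite n3 in rows; rewrite n3 m3 in cor.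
have d4 : data_intact t4.
  case: d3 => ? ? ? tq3; split=> [|||i j ni]; try by rewrite ?nmem_run// rmem_run.
  by rewrite rows ?tq3.
have g4 : output_good t3 -> output_good t4 by exact: output_good_run.
have [d5 g5 c5] := try_peak_good d4.
split=> // [/g1/g2/g3/g4/g5//|on win].
have [i j ni|bn j jm|i j ni|j jm|/c2/g3/g4/g5//|/c5//] := win (rmem t1 3) (rmem t4 3).
- by case: d1 => _ _ _; apply.
- rewrite /t1 -{1}tn run_place ?tn ?tm// /placed.
  by case: ifP => _; rewrite tq.
- by case: d4 => _ _ _; apply.
- by rewrite cor// A3 r3.
Qed.

Lemma search_good i0 j0 k0 :
  (i0 <= n)%N -> (j0 <= m)%N -> (k0 <= n + 1)%N -> k0 != n ->
  winning m n M a q i0 j0 k0 -> output_good (run search input).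
Proof.
move=> li lj lk kn win.
have stA v z t : v != 0%N -> data_intact t -> data_intact (set_counter v z t).
  move=> v0 [t0 tM ta tq]; split=> //=.
  by rewrite update_other// eq_sym.
have stG v z t : (2 < v)%N -> output_good t -> output_good (set_counter v z t).
  by move=> v2; rewrite /output_good /output /= !update_other//; lia.
have [//|||i t _ [un _] ti td|//|_ _] :=
  @for_hit _ 9 1 1 (PFor 10 0 1 (PFor 11 1 2 try_candidate)) input data_intact
    output_good (fun i => i = i0).
- by move=> z t; exact: stA.
- by move=> z t; exact: stG.
- have tm : nmem t 0 0 0 = m by case: td => ->.
  have [//|||j u _ [nu _] uj ud|//|rd rg rh] :=
    @for_hit _ 10 0 1 (PFor 11 1 2 try_candidate) t data_intact output_good
      (fun j => nmem t 9 0 0 = i0 /\ j = j0).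
  + by move=> z u; exact: stA.
  + by move=> z u; exact: stG.
  + have un' : nmem u 0 0 1 = n by case: ud => ->.
    have [//|||k w _ [nw _] wk wd|//|rd rg rh] :=
      @for_hit _ 11 1 2 try_candidate u data_intact output_good
        (fun k => [/\ nmem u 9 0 0 = i0, nmem u 10 0 0 = j0 & k = k0]).
    * by move=> z w; exact: stA.
    * by move=> z w; exact: stG.
    * have [rd rg rh] := try_candidate_good wd.
      split=> // -[u9 u10 kk]; apply: rh; rewrite wk kk//.
      by rewrite !nw// u9 u10.
    split=> // -[t9 jj]; apply: rh; exists k0; last by rewrite nu// t9 uj.
    by rewrite un' addn2 ltnS (leq_trans lk)// addn1.
  split=> // ii; apply: rh; exists j0; last by rewrite ti.
  by rewrite tm addn1 ltnS.
by apply; exists i0 => //=; rewrite addn1 ltnS.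
Qed.

(** The superdifferential condition at [q i], evaluated at [q k], is the Afriat
inequality. *)
Lemma rationalizable_winning : peak_oriented_rationalizable D ->
  exists i0 j0 k0, [/\ (i0 <= n)%N, (j0 <= m)%N, (k0 <= n + 1)%N, k0 != n &
    winning m n M a q i0 j0 k0].
Proof.
case: surveyD => _ a_neq0 _ qB.
move=> [u [_ _ [y [lam [ybox [_ _ super orth pos]]]]]].
apply: (exists_winning (lam := cell lam) (U := cell (fun i => u (answer D i)))
  (ystar := cell (fun j => y 0 j))).
- by move=> i j li lj; rewrite (normalE (Ordinal li) (Ordinal lj)).
- by move=> j; exact: normal_out.
- by move=> j; apply: answer_out; rewrite addn1.
- by move=> j lj; rewrite (boundE (Ordinal lj)) (cell_ord _ (Ordinal lj)) ybox.
- move=> i j li lj; rewrite (normalE (Ordinal li) (Ordinal lj)).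
  rewrite (answerE (Ordinal li) (Ordinal lj)) (cell_ord _ (Ordinal lj)).
  by rewrite (cell_ord _ (Ordinal li)) mulrA orth.
- move=> i j li lj; rewrite (answerE (Ordinal li) (Ordinal lj)).
  rewrite (cell_ord _ (Ordinal lj)) (cell_ord _ (Ordinal li)) => qy.
  have /pos : answer D (Ordinal li) != y by apply: contraNneq qy => ->.
  by rewrite innerZl; apply: contraTneq => ->; rewrite mul0r ltxx.
- move=> i k li lk; rewrite !(cell_ord _ (Ordinal li)) !(cell_ord _ (Ordinal lk)).
  have := super (Ordinal li) _ (qB (Ordinal lk)).1; rewrite innerZl.
  congr (_ <= _ + _ * _); apply: eq_bigr => j _.
  by rewrite !mxE (normalE (Ordinal li)) (answerE (Ordinal li)) (answerE (Ordinal lk)).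
Qed.

End Search.

Theorem corollary1 (R : realType) :
  exists (prog : cmd) (c d : nat),
    forall (m n : nat) (D : dataset R m n),
      survey_dataset D ->
      peak_oriented_rationalizable D ->
      exists (t : nat) (s : state R),
        [/\ exec prog (input_state D) t s,
            (t <= c * (m + n + 1) ^ d)%N,
            valid_parameters (output n s)
          & rationalizing_utility D (utility D (output n s))].
Proof.
(* Loop bounds are at most [m + n + 2], which is below [3 * (m + n + 1)]. *)
exists (translate search), (weight search * 3 ^ nesting search)%N, (nesting search).
move=> m n D surveyD /(rationalizable_winning surveyD)
  [i0 [j0 [k0 [li lj lk kn win]]]].
have [valid rat] := search_good surveyD li lj lk kn win.
have [||t ex le_t] := @exec_run R search (input_state D) (3 * (m + n + 1)).
- by [].
- by move=> x /=; case: x => [|[|x]]; lia.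
exists t, (run search (input_state D)); split=> //.
by rewrite -mulnA -expnMn.
Qed.
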